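(* Let $\mu$ be a unimodular probability measure on $\mathcal G_\ast$ of bounded degree, i.e. there is $D\in\mathbb N$ such that for $\mu$-a.e. $[G,o]$ one has $\deg_G(v)\le D$ for all $v\in V(G)$, and let $(f,h,\psi)$ be an admissible potential triple for $\mu$ (as defined in the context). Let $x,y\in\mathcal H$. Then the potential functional $\Phi:\mathcal H\to\mathbb R$ is Gâteaux differentiable at $x$, and $$\langle\nabla\Phi(x),y\rangle_{\mathcal H}=\int_{\mathcal G_\ast}\bigg\langle\nabla f([G,o],x([G,o]))+\sum_{v\sim o}\nabla_1h([G,o,v],x([G,o]),x([G,v])),\;y([G,o])\bigg\rangle_H\mu(d[G,o]).$$
   Context: Graphs. All graphs $G=(V,E)$ are simple (undirected, no loops or multiple edges), locally finite, with finite or countably infinite vertex set $V=V(G)$; $u\sim v$ means $\{u,v\}\in E$. A rooted graph $(G,o)$ is a graph with a distinguished vertex $o$; rooted isomorphisms are graph isomorphisms mapping root to root, and $[G,o]$ is the isomorphism class. $B_r(G,o)$ is the rooted subgraph induced by the vertices at graph distance at most $r$ from $o$. $\mathcal G_\ast$ is the set of isomorphism classes of countable, connected, rooted graphs with metric $d_\ast([G,o],[G',o'])=\inf_{r\in\mathbb N_0}\{2^{-r}:B_r(G,o)\cong B_r(G',o')\}$. $\mathcal G_{\ast\ast}$ is the analogous space of isomorphism classes $[G,o_1,o_2]$ of countable, connected, doubly rooted graphs (isomorphisms preserve both roots in order), with the analogous metric $d_{\ast\ast}$. Both carry Borel $\sigma$-fields. A probability measure $\mu$ on $\mathcal G_\ast$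 is unimodular if for every measurable $T:\mathcal G_{\ast\ast}\to[0,\infty]$, $\int\sum_{v\in V(G)}T([G,o,v])\,\mu(d[G,o])=\int\sum_{v\in V(G)}T([G,v,o])\,\mu(d[G,o])$. Spaces. $H$ is a separable real Hilbert space, and $\mathcal H=L^2(\mu,H)$ is the Hilbert space of measurable $x:\mathcal G_\ast\to H$ with $\int\|x([G,o])\|_H^2\,\mu(d[G,o])<\infty$, with inner product $\langle x,y\rangle_{\mathcal H}=\int\langle x([G,o]),y([G,o])\rangle_H\,\mu(d[G,o])$. Admissible potential triple. Measurable functions $f:\mathcal G_\ast\times H\to\mathbb R$ (private cost), $h:\mathcal G_{\ast\ast}\times H\times H\to\mathbb R$ (interaction cost) and $\psi:\mathcal G_{\ast\ast}\times H\times H\to\mathbb R$ form an admissible potential triple for $\mu$ if the following hold ($\nabla$ is the Gâteaux gradient; $\nabla_1,\nabla_2$ are partial gradients in the first and second $H$-argument). (i) For $\mu$-a.e. $[G,o]$, $a\mapsto f([G,o],a)$ is Gâteaux differentiable on $H$. (ii) For $\mu$-a.e. $[G,o]$ and every $v\sim o$: $a\mapsto h([G,o,v],a,b)$ is Gâteaux differentiable on $H$ for every $b\in H$; $(a,b)\mapsto\psi([G,o,v],a,b)$ is Gâteaux differentiable on $H\times H$; and for all $a,b\in H$, $\nabla_1\psi([G,o,v],a,b)=\nabla_1h([G,o,v],a,b)$ and $\nabla_2\psi([G,o,v],a,b)=\nabla_1h([G,v,o],b,a)$. (iii) There are constants $L_f,L_h\ge0$ such that for $\mu$-a.e. $[G,o]$,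 every $v\sim o$ and all $a,a',b,b'\in H$: $\|\nabla f([G,o],a)-\nabla f([G,o],a')\|_H\le L_f\|a-a'\|_H$ and $\|\nabla_1h([G,o,v],a,b)-\nabla_1h([G,o,v],a',b')\|_H\le L_h(\|a-a'\|_H+\|b-b'\|_H)$. (iv) There is $a_\ast\in H$ such that the functions $|f([G,o],a_\ast)|$, $\|\nabla f([G,o],a_\ast)\|_H^2$, $\sum_{v\sim o}|\psi([G,o,v],a_\ast,a_\ast)|$ and $\sum_{v\sim o}\|\nabla_1h([G,o,v],a_\ast,a_\ast)\|_H^2$ of $[G,o]$ all have finite $\mu$-integral. Potential functional. $\Phi(x)=\int_{\mathcal G_\ast}\big[f([G,o],x([G,o]))+\frac12\sum_{v\sim o}\psi([G,o,v],x([G,o]),x([G,v]))\big]\mu(d[G,o])$ for $x\in\mathcal H$; it is finite on $\mathcal H$ under these hypotheses. *)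

(* Defs.v *)
From HB Require Import structures.
From mathcomp Require Import all_boot all_order all_algebra finmap.
From mathcomp Require Import all_classical all_reals all_analysis.
From mathcomp Require Import measurable_realfun.

Set Implicit Arguments.
Unset Strict Implicit.
Unset Printing Implicit Defensive.

Import Order.TTheory GRing.Theory Num.Theory.
Import numFieldNormedType.Exports.

Local Open Scope classical_set_scope.
Local Open Scope ring_scope.
Local Open Scope quotient_scope.

(* Every finite or countably infinite graph is isomorphic to one whose vertex
   set is a subset of nat, so isomorphism classes lose nothing by taking
   vertices in nat. *)
Record graph := Graph {
  vset : pred nat;
  edge : rel {v : nat | vset v};
  edge_sym : symmetric edge;
  edge_irr : irreflexive edge;
  edge_locfin : forall v, finite_set [set u | edge v u];
  edge_connected : forall u v, exists2 p, path edge u p & last u p = v }.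

Definition vertex (G : graph) : Type := {v : nat | vset G v}.
Coercion vertex : graph >-> Sortclass.

Definition nbrs (G : graph) (v : G) : set G := [set u : G | edge v u].

Definition deg (G : graph) (v : G) : nat := #|` fset_set (nbrs v)|.

(* [rgraph 1] and [rgraph 2] are the singly and doubly rooted graphs; roots
   are ordered and may coincide. *)
Record rgraph (n : nat) := RGraph { rg :> graph; roots : n.-tuple rg }.

(* Vertices at graph distance at most r from some root. *)
Definition gball (n : nat) (G : rgraph n) (r : nat) : set G :=
  [set v : G | exists (o : G) (p : seq G),
    [/\ o \in roots G, path (@edge G) o p, last o p = v & (size p <= r)%N]].
Arguments gball {n} G r.

(* phi restricts to an isomorphism between the subgraphs induced by A and A'
   and maps the roots to the roots, in order. *)
Definition rooted_iso (n : nat) (G G' : rgraph n) (A : set G) (A' : set G')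
    (phi : G -> G') : Prop :=
  [/\ set_bij A A' phi,
      (forall u v, A u -> A v -> edge (phi u) (phi v) = edge u v) &
      map phi (roots G) = roots G' :> seq G'].

Definition rgraph_iso (n : nat) (G G' : rgraph n) : bool :=
  `[< exists phi : G -> G', rooted_iso setT setT phi >].

Definition gball_iso (n : nat) (r : nat) (G G' : rgraph n) : Prop :=
  exists phi : G -> G', rooted_iso (gball G r) (gball G' r) phi.

HB.instance Definition _ n := gen_eqMixin (rgraph n).
HB.instance Definition _ n := gen_choiceMixin (rgraph n).

Lemma rgraph_iso_refl n : reflexive (@rgraph_iso n).
Proof.
move=> G; apply/asboolP; exists id; split=> //; last by rewrite map_id.
by rewrite setTT_bijective; exists id.
Qed.

Lemma rgraph_iso_sym_imp n (G G' : rgraph n) :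
  rgraph_iso G G' -> rgraph_iso G' G.
Proof.
move=> /asboolP[phi []].
rewrite setTT_bijective => -[psi phiK psiK] hE hr.
apply/asboolP; exists psi; split.
- by rewrite setTT_bijective; exists phi.
- by move=> u v _ _; rewrite -hE// !psiK.
- by rewrite -hr -map_comp (eq_map (g := id)) ?map_id.
Qed.

Lemma rgraph_iso_sym n : symmetric (@rgraph_iso n).
Proof. by move=> G G'; apply/idP/idP; exact: rgraph_iso_sym_imp. Qed.

Lemma rgraph_iso_trans n : transitive (@rgraph_iso n).
Proof.
move=> G2 G1 G3 /asboolP[f []]; rewrite setTT_bijective => bf hf rf.
move=> /asboolP[g []]; rewrite setTT_bijective => bg hg rg'.
apply/asboolP; exists (g \o f); split.
- by rewrite setTT_bijective; exact: bij_comp.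
- by move=> u v _ _ /=; rewrite hg// hf.
- by rewrite map_comp rf rg'.
Qed.

Canonical rgraph_iso_equiv n := EquivRel (@rgraph_iso n)
  (@rgraph_iso_refl n) (@rgraph_iso_sym n) (@rgraph_iso_trans n).

Definition Gspace (n : nat) : Type := {eq_quot (@rgraph_iso n)}.
HB.instance Definition _ n := Quotient.on (Gspace n).
HB.instance Definition _ n := Choice.on (Gspace n).

Section one_vertex.
Let e : rel {v : nat | v == 0%N} := fun _ _ => false.
Let v_uniq (u v : {v : nat | v == 0%N}) : u = v.
Proof. by apply: val_inj; rewrite (eqP (valP u)) (eqP (valP v)). Qed.
Let e_locfin v : finite_set [set u | e v u].
Proof. by rewrite (_ : [set _ | _] = set0)// -subset0. Qed.
Let e_connected u v : exists2 p, path e u p & last u p = v.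
Proof. by exists [::] => //=; exact: v_uniq. Qed.
Definition graph1 : graph :=
  @Graph (pred1 0%N) e (fun _ _ => erefl) (fun _ => erefl) e_locfin e_connected.
Definition rgraph1 n : rgraph n :=
  @RGraph n graph1 (nseq_tuple n (exist _ 0%N (eqxx 0%N) : graph1)).
End one_vertex.

(* The library's measurable types are pointed. *)
HB.instance Definition _ n := isPointed.Build (Gspace n) (\pi_(Gspace n) (rgraph1 n)).

Notation Gstar := (Gspace 1).
Notation Gstar2 := (Gspace 2).

Definition cls1 (G : graph) (o : G) : Gstar :=
  \pi_(Gspace 1) (RGraph [tuple o]).
Definition cls2 (G : graph) (o v : G) : Gstar2 :=
  \pi_(Gspace 2) (RGraph [tuple o; v]).

(* A representative (G, o) of a class in G_*.  All uses below are invariant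
   under rooted isomorphism, so the choice of representative is immaterial. *)
Definition gr (g : Gstar) : graph := repr g.
Definition groot (g : Gstar) : gr g := thead (roots (repr g)).

Definition rnbrs (g : Gstar) : set (gr g) := nbrs (groot g).
Arguments rnbrs : clear implicits.

(* For n = 1 the set contains 1 = 2^-0 anyway, because balls of radius 0 are
   single vertices.  For n = 2 even the balls of radius 0 may fail to be
   isomorphic; the distance is then 1 (in [R], [inf set0] would be 0). *)
Definition gdist (R : realType) (n : nat) (g g' : Gspace n) : R :=
  inf ([set 2 ^- r | r in [set r | gball_iso r (repr g) (repr g')]]
       `|` [set 1]).

Definition gopen (R : realType) (n : nat) : set (set (Gspace n)) :=
  [set U | forall g, U g ->
    exists2 e : R, 0 < e & forall g', gdist R g g' < e -> U g'].
Arguments gopen : clear implicits.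

Notation BGstar R := (g_sigma_algebraType (gopen R 1)).
Notation BGstar2 R := (g_sigma_algebraType (gopen R 2)).

HB.mixin Record NormedModule_isHilbert (R : realType) V
    & CompleteNormedModule R V := {
  inner : V -> V -> R;
  innerC : forall u v, inner u v = inner v u;
  innerDl : forall u v w, inner (u + v) w = inner u w + inner v w;
  innerZl : forall (a : R) u v, inner (a *: u) v = a * inner u v;
  inner_norm : forall u, inner u u = `|u| ^+ 2 }.

#[short(type="hilbertType")]
HB.structure Definition Hilbert (R : realType) :=
  { V of NormedModule_isHilbert R V & CompleteNormedModule R V }.

Definition separable_space (T : topologicalType) : Prop :=
  exists2 S : set T, countable S & dense S.

Definition inner2 (R : realType) (H : hilbertType R) (u v : H * H) : R :=
  inner u.1 v.1 + inner u.2 v.2.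

Notation Borel T := (g_sigma_algebraType (@open T)).

(* Gateaux differentiability at a with gradient g: the derivative at a is the
   bounded linear form v |-> <g, v>.  [D] is the vector space under
   consideration, with inner product [ip], given as a subspace of [V]: it is
   the whole of [V] for Hilbert spaces, and L^2 inside the space of all
   functions, where gradients are determined up to a.e. equality. *)
Definition is_gradient (R : realType) (V : lmodType R) (D : set V)
    (ip : V -> V -> R) (F : V -> R) (a g : V) : Prop :=
  D g /\ forall v, D v ->
    h^-1 * (F (a + h *: v) - F a) @[h --> (0 : R)^'] --> ip g v.

Definition gateaux_differentiable (R : realType) (V : lmodType R) (D : set V)
    (ip : V -> V -> R) (F : V -> R) (a : V) : Prop :=
  exists g, is_gradient D ip F a g.

Definition gradient (R : realType) (V : lmodType R) (D : set V)
    (ip : V -> V -> R) (F : V -> R) (a : V) : V :=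
  xget 0 [set g | is_gradient D ip F a g].

Notation gdiffH := (@gateaux_differentiable _ _ setT (@inner _ _)).
Notation gdiffHH := (@gateaux_differentiable _ _ setT (@inner2 _ _)).
Notation grad := (@gradient _ _ setT (@inner _ _)).

Definition grad1 (R : realType) (H : hilbertType R) (k : H -> H -> R)
  (a b : H) : H := grad (fun a' => k a' b) a.
Definition grad2 (R : realType) (H : hilbertType R) (k : H -> H -> R)
  (a b : H) : H := grad (fun b' => k a b') b.

Section mean_field.
Context (R : realType) (mu : probability (BGstar R) R) (H : hilbertType R).

Definition unimodular : Prop :=
  forall T : Gstar2 -> \bar R,
    measurable_fun setT (T : BGstar2 R -> \bar R) ->
    (forall z, (0 <= T z)%E) ->
    (\int[mu]_g (\esum_(v in [set: gr g]) T (cls2 (groot g) v)) =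
     \int[mu]_g (\esum_(v in [set: gr g]) T (cls2 v (groot g))))%E.

Definition bounded_degree : Prop :=
  exists D : nat, \forall g \ae mu, forall v : gr g, (deg v <= D)%N.

(* As usual, elements of L^2 are represented by functions. *)
Definition L2 : set (Gstar -> H) :=
  [set x | measurable_fun setT (x : BGstar R -> Borel H) /\
           (\int[mu]_g ((`|x g| ^+ 2)%:E) < +oo)%E].

Definition innerL2 (x y : Gstar -> H) : R := \int[mu]_g (inner (x g) (y g)).

Record admissible (f : Gstar -> H -> R) (h psi : Gstar2 -> H -> H -> R)
    : Prop := Admissible {
  adm_meas_f :
    measurable_fun setT (fun p : BGstar R * Borel H => f p.1 p.2);
  adm_meas_h :
    measurable_fun setT
      (fun p : BGstar2 R * Borel H * Borel H => h p.1.1 p.1.2 p.2);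
  adm_meas_psi :
    measurable_fun setT
      (fun p : BGstar2 R * Borel H * Borel H => psi p.1.1 p.1.2 p.2);
  adm_diff_f : \forall g \ae mu, forall a : H, gdiffH (f g) a;
  adm_diff_h_psi : \forall g \ae mu, forall v, rnbrs g v ->
    let ov := cls2 (groot g) v in let vo := cls2 v (groot g) in
    [/\ forall a b : H, gdiffH (fun a' => h ov a' b) a,
        forall p : H * H, gdiffHH (fun q => psi ov q.1 q.2) p &
        forall a b : H, grad1 (psi ov) a b = grad1 (h ov) a b /\
                        grad2 (psi ov) a b = grad1 (h vo) b a];
  (* The bound on [grad (f g)] does not involve v, hence is also required when
     the root is isolated. *)
  adm_lipschitz : exists Lf Lh : R, [/\ 0 <= Lf, 0 <= Lh,
    \forall g \ae mu, forall a a' : H,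
      `|grad (f g) a - grad (f g) a'| <= Lf * `|a - a'| &
    \forall g \ae mu, forall v, rnbrs g v ->
      let ov := cls2 (groot g) v in forall a a' b b' : H,
      `|grad1 (h ov) a b - grad1 (h ov) a' b'|
        <= Lh * (`|a - a'| + `|b - b'|)];
  adm_integrable : exists a : H,
    [/\ (\int[mu]_g (`|f g a|)%:E < +oo)%E,
        (\int[mu]_g (`|grad (f g) a| ^+ 2)%:E < +oo)%E,
        (\int[mu]_g
           (\sum_(v \in rnbrs g) `|psi (cls2 (groot g) v) a a|)%:E < +oo)%E &
        (\int[mu]_g
           (\sum_(v \in rnbrs g) `|grad1 (h (cls2 (groot g) v)) a a| ^+ 2)%:E
           < +oo)%E] }.

Definition potential_density (f : Gstar -> H -> R) (psi : Gstar2 -> H -> H -> R)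
    (x : Gstar -> H) (g : Gstar) : R :=
  f g (x g) + 2^-1 *
    \sum_(v \in rnbrs g) psi (cls2 (groot g) v) (x g) (x (cls1 v)).

Definition potential (f : Gstar -> H -> R) (psi : Gstar2 -> H -> H -> R)
    (x : Gstar -> H) : R := \int[mu]_g potential_density f psi x g.

End mean_field.

Arguments L2 {R} mu H _ : rename.
Arguments innerL2 {R} mu {H} x y : rename.

(* Main.v *)
(* Along a segment, the mean value theorem and the Lipschitz bounds on the
   gradients give, off a null set, a second-order Taylor estimate
     |dens (x + t v) - dens x - t L(x, v)| <= t^2 K(v)
   for the density of the potential, with L and K integrable, so no dominated
   convergence is needed.  The same estimate around a constant function a_*
   shows that the density is integrable.  In L, each edge (o, v) contributes
   <grad_1 h(o, v), y(o)> and <grad_1 h(v, o), y(v)>; unimodularity (mass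
   transport) makes the integrals of the two terms equal, which cancels the
   factor 1/2.  It also bounds the integral of the sum of |x(v)|^2 over the
   neighbours v by D times that of |x|^2, and turns null sets of roots into
   null sets of neighbours.

   Sums over neighbours of a measurable function on G_** are measurable on G_*:
   for the indicator of an open set the sum is lower semicontinuous, and the
   pi-lambda theorem does the rest.  The gradients are only controlled off a
   null set; they are replaced by 0 there, and are then measurable because they
   are weakly measurable (H being separable). *)

Require Import Defs.
From HB Require Import structures.
From mathcomp Require Import all_boot all_order all_algebra finmap.
From mathcomp Require Import all_classical all_reals all_analysis.
From mathcomp Require Import measurable_realfun.
From mathcomp Require Import lra.

Set Implicit Arguments.
Unset Strict Implicit.
Unset Printing Implicit Defensive.

Import Order.TTheory GRing.Theory Num.Theory.
Import numFieldNormedType.Exports.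

(* [fingraph] shadows [rgraph] *)
Import Defs.

Local Open Scope classical_set_scope.
Local Open Scope ring_scope.

(** * Balls of rooted graphs *)

Lemma gball_root n (G : rgraph n) r (c : G) : c \in roots G -> gball G r c.
Proof. by move=> cG; exists c, [::]. Qed.

Lemma gball0 n (G : rgraph n) (v : G) : gball G 0 v -> v \in roots G.
Proof. by move=> [c [p [cG _ <-]]]; rewrite leqn0 size_eq0 => /eqP ->. Qed.

Lemma gballSP n (G : rgraph n) r (v : G) :
  gball G r.+1 v <-> gball G r v \/ exists2 u, gball G r u & edge u v.
Proof.
split=> [[c [p [cG + <-]]]|[[c [p [cG cp <- pr]]]|[u [c [p [cG cp <- pr]]]] uv]].
- case/lastP: p => [|p w]; first by left; exact: gball_root.
  rewrite rcons_path last_rcons size_rcons ltnS => /andP[cp pw] pr.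
  by right; exists (last c p) => //; exists c, p.
- by exists c, p; split=> //; exact: leqW.
- exists c, (rcons p v).
  by rewrite rcons_path cp last_rcons size_rcons ltnS; split.
Qed.

Lemma gball_le n (G : rgraph n) r r' : (r <= r')%N -> gball G r `<=` gball G r'.
Proof.
by move=> rr' v [c [p [cG cp pv pr]]]; exists c, p; split=> //; exact: leq_trans rr'.
Qed.

(** A path of length at most r from a root stays in the ball, hence in [A] or [A'], where [phi]
    respects edges. Induction on the radius shows that [phi] sends each smaller ball into its
    counterpart, then onto it. *)
Lemma rooted_iso_gball n (G G' : rgraph n) (A : set G) (A' : set G')
    (phi : G -> G') r :
  gball G r `<=` A -> gball G' r `<=` A' -> rooted_iso A A' phi ->
  rooted_iso (gball G r) (gball G' r) phi.
Proof.
move=> GA GA' [[phiA phi_inj phi_surj] phiE phir].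
have rG' o : o \in roots G -> phi o \in roots G'.
  by move=> oG; rewrite -[_ \in _]/(_ \in (roots G' : seq G')) -phir map_f.
have homo k : (k <= r)%N -> forall v, gball G k v -> gball G' k (phi v).
  elim: k => [_ v /gball0 vG|k IH kr v]; first exact/gball_root/rG'.
  have gA u : gball G k u -> A u by move/(gball_le (ltnW kr)); exact: GA.
  move=> kv; apply/gballSP; case/gballSP: (kv) => [/IH|[u ku uv]].
    by move=> /(_ (ltnW kr)); left.
  right; exists (phi u); first by apply: IH => //; exact: ltnW.
  by rewrite phiE//; [exact: gA|apply: GA; exact: gball_le kv].
have surj k : (k <= r)%N -> forall v', gball G' k v' ->
    exists2 v, gball G k v & phi v = v'.
  elim: k => [_ v' /gball0|k IH kr v' kv'].
    rewrite -[_ \in _]/(_ \in (roots G' : seq G')) -phir => /mapP[v vG ->].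
    by exists v => //; exact: gball_root.
  case/gballSP: (kv') => [/(IH (ltnW kr))[v kv <-]|[u' ku' u'v']].
    by exists v => //; apply/gballSP; left.
  have [u ku uE] := IH (ltnW kr) _ ku'.
  have [v Av vE] := phi_surj _ (GA' _ (gball_le kr kv')).
  exists v => //; apply/gballSP; right; exists u => //.
  by rewrite -phiE ?vE ?uE//; apply: GA; exact: gball_le (ltnW kr) _ ku.
split=> //.
- split=> [v|u v /set_mem uG /set_mem vG|v' /(surj _ (leqnn r))[v vG <-]].
  + exact: homo.
  + by apply: phi_inj; apply/mem_set; exact: GA.
  + by exists v.
- by move=> u v uG vG; apply: phiE; exact: GA.
Qed.

Lemma gball_iso_trans n r (G1 G2 G3 : rgraph n) :
  gball_iso r G1 G2 -> gball_iso r G2 G3 -> gball_iso r G1 G3.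
Proof.
move=> [f [fb fE fr]] [g [gb gE gr]]; exists (g \o f); split.
- exact: set_bij_comp gb.
- move=> u v uG vG; rewrite /= gE ?fE//; exact: (set_bij_homo fb).
- by rewrite map_comp fr.
Qed.

Lemma gball_iso_le n r r' (G G' : rgraph n) :
  (r <= r')%N -> gball_iso r' G G' -> gball_iso r G G'.
Proof.
move=> rr' [phi h]; exists phi.
by apply: rooted_iso_gball h => //; exact: gball_le.
Qed.

Lemma rgraph_iso_gball n r (G G' : rgraph n) : rgraph_iso G G' -> gball_iso r G G'.
Proof. by move=> /asboolP[phi h]; exists phi; exact: rooted_iso_gball h. Qed.

Lemma repr_pi_iso n (G : rgraph n) : rgraph_iso (repr (\pi_(Gspace n) G)%qT) G.
Proof. by apply/eqmodP; rewrite reprK. Qed.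

(** Frees ball comparisons from the chosen representatives: each graph is isomorphic to the
    representative of its class. *)
Lemma gball_iso_repr n r (G G' : rgraph n) :
  gball_iso r (repr (\pi_(Gspace n) G)%qT) (repr (\pi_(Gspace n) G')%qT) <->
  gball_iso r G G'.
Proof.
have h (K : rgraph n) : gball_iso r (repr (\pi_(Gspace n) K)%qT) K.
  exact: rgraph_iso_gball (repr_pi_iso K).
have h' (K : rgraph n) : gball_iso r K (repr (\pi_(Gspace n) K)%qT).
  by apply: rgraph_iso_gball; apply: rgraph_iso_sym_imp; exact: repr_pi_iso.
split=> GG'.
- exact: gball_iso_trans (gball_iso_trans (h' _) GG') (h _).
- exact: gball_iso_trans (gball_iso_trans (h _) GG') (h' _).
Qed.

(** If the infimum is below 2^-r, some element of the set is too. It cannot be the added 1, so it is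
    2^-k with k > r, and balls of radius k restrict to balls of radius r. *)
Lemma gdistP (R : realType) n (g g' : Gspace n) r :
  (gball_iso r (repr g) (repr g') -> gdist R g g' <= 2 ^- r) /\
  (gdist R g g' < 2 ^- r -> gball_iso r (repr g) (repr g')).
Proof.
rewrite /gdist; set E := (X in inf X).
have [E0 Elb] : has_inf E.
  split; first by exists 1; right.
  by exists 0 => _ [[k _ <-]|->]; rewrite ?invr_ge0 ?exprn_ge0.
split=> [gg'|]; first by apply: (ge_inf Elb); left; exists r.
move=> /(inf_lt E0)[_ [[k kgg' <-]|->]].
  rewrite ltf_pV2 ?posrE ?exprn_gt0// ltr_eXn2l ?ltr1n// => rk.
  by apply: gball_iso_le kgg'; exact: ltnW.
by rewrite ltNge invf_le1 ?exprn_gt0// ?exprn_ege1// ler1n.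
Qed.

(** Eliminates the metric: openness becomes a condition on balls alone, the form in which every
    measurability proof on graph spaces uses it. *)
Lemma gopenP (R : realType) n (U : set (Gspace n)) :
  gopen R n U <-> forall g, U g -> exists r, forall g',
    gball_iso r (repr g) (repr g') -> U g'.
Proof.
split=> UP g /UP.
- move=> [e e0 eU].
  have [r re] : exists r : nat, (2 : R) ^- r < e.
    have [k _ /(_ k (leqnn k))] := near_infty_natSinv_expn_lt (PosNum e0).
    by rewrite mul1r; exists k.
  by exists r => g' gg'; apply: eU; apply: le_lt_trans re; apply: (gdistP R g g' r).1.
- move=> [r rU]; exists (2 ^- r); first by rewrite invr_gt0 exprn_gt0.
  by move=> g' /(gdistP R g g' r).2; exact: rU.
Qed.

(** * Unrooted isomorphisms, and the maps between singly and doubly rooted classes *)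

Definition giso (G G' : graph) (phi : G -> G') :=
  bijective phi /\ forall u v, edge (phi u) (phi v) = edge u v.

Lemma cls1_giso (G G' : graph) (phi : G -> G') (c : G) :
  giso phi -> cls1 (phi c) = cls1 c.
Proof.
move=> [phib phiE]; apply/esym/eqmodP/asboolP; exists phi.
by split=> //; rewrite setTT_bijective.
Qed.

Lemma cls2_giso (G G' : graph) (phi : G -> G') (c v : G) :
  giso phi -> cls2 (phi c) (phi v) = cls2 c v.
Proof.
move=> [phib phiE]; apply/esym/eqmodP/asboolP; exists phi.
by split=> //; rewrite setTT_bijective.
Qed.

Lemma repr_giso n (G : rgraph n) : exists2 phi : G -> repr (\pi_(Gspace n) G)%qT,
  giso phi & map phi (roots G) = roots (repr (\pi_(Gspace n) G)%qT) :> seq _.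
Proof.
have /asboolP[phi [phib phiE phir]] := rgraph_iso_sym_imp (repr_pi_iso G).
by exists phi => //; split=> [|u v]; [rewrite -setTT_bijective|exact: phiE].
Qed.

Lemma cls1_repr (G : graph) (c : G) : exists2 phi : G -> gr (cls1 c),
  giso phi & phi c = groot (cls1 c).
Proof.
have [phi phig /= phir] := repr_giso (RGraph [tuple c]); exists phi => //.
by rewrite /groot; move: phir; case: (tupleP (roots _)) => a t; rewrite theadE => -[].
Qed.

Lemma cls1_groot (g : Gstar) : cls1 (groot g) = g.
Proof.
rewrite -[RHS]reprK /cls1 /groot /gr; case: (repr g) => G t /=.
congr (\pi _)%qT; congr RGraph; apply: val_inj; case: t => -[|a []]//= i.
Qed.

(** The maps from here to [adj] read off the chosen representative; the [_cls2] lemmas below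
    evaluate them on any doubly rooted graph of the class. *)
Definition root1 (z : Gstar2) : repr z := tnth (roots (repr z)) ord0.
Definition root2 (z : Gstar2) : repr z := tnth (roots (repr z)) ord_max.
Definition pi1 (z : Gstar2) : Gstar := cls1 (root1 z).
Definition pi2 (z : Gstar2) : Gstar := cls1 (root2 z).
Definition swap (z : Gstar2) : Gstar2 := cls2 (root2 z) (root1 z).
Definition adj (z : Gstar2) : bool := edge (root1 z) (root2 z).

Lemma roots2E (G : rgraph 2) :
  roots G = [:: tnth (roots G) ord0; tnth (roots G) ord_max] :> seq _.
Proof. by case: G => G t /=; case: t => -[|a [|b []]]. Qed.

Lemma cls2_repr (G : graph) (c v : G) : exists2 phi : G -> repr (cls2 c v),
  giso phi & phi c = root1 (cls2 c v) /\ phi v = root2 (cls2 c v).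
Proof.
have [phi phig phir] := repr_giso (RGraph [tuple c; v]); exists phi => //.
by move: phir; rewrite (roots2E (repr _)) /= => -[].
Qed.

Lemma pi1_cls2 (G : graph) (c v : G) : pi1 (cls2 c v) = cls1 c.
Proof.
by rewrite /pi1; have [phi phig [<- _]] := cls2_repr c v; exact: cls1_giso.
Qed.

Lemma pi2_cls2 (G : graph) (c v : G) : pi2 (cls2 c v) = cls1 v.
Proof.
by rewrite /pi2; have [phi phig [_ <-]] := cls2_repr c v; exact: cls1_giso.
Qed.

Lemma swap_cls2 (G : graph) (c v : G) : swap (cls2 c v) = cls2 v c.
Proof.
by rewrite /swap; have [phi phig [<- <-]] := cls2_repr c v; exact: cls2_giso.
Qed.

Lemma adj_cls2 (G : graph) (c v : G) : adj (cls2 c v) = edge c v.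
Proof. by rewrite /adj; have [phi [_ phiE] [<- <-]] := cls2_repr c v; exact: phiE. Qed.

(** [rnbrs (cls1 v)] lives in the representative of the class, not in [G]; the isomorphism between
    the two carries [c] to the required neighbour. *)
Lemma rnbrs_cls1 (G : graph) (c v : G) : edge c v ->
  exists2 w, rnbrs (cls1 v) w & cls2 (groot (cls1 v)) w = cls2 v c.
Proof.
move=> cv; have [phi phig phiv] := cls1_repr v; exists (phi c).
  by rewrite /rnbrs /nbrs /= -phiv phig.2 edge_sym.
by rewrite -phiv; exact: cls2_giso.
Qed.

(** Common core of the locality lemmas below: a ball isomorphism survives a change of roots,
    provided that the balls about the new roots lie inside the old ones. *)
Lemma reroot_gball_iso n m (G G' : rgraph m) (s : n.-tuple G) (s' : n.-tuple G')
    (phi : G -> G') r r' :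
  rooted_iso (gball G r') (gball G' r') phi -> map phi s = s' :> seq _ ->
  gball (RGraph s) r `<=` gball G r' -> gball (RGraph s') r `<=` gball G' r' ->
  gball_iso r (RGraph s) (RGraph s').
Proof.
move=> [phib phiE _] ss' sG s'G; exists phi.
by apply: (rooted_iso_gball sG s'G); split.
Qed.

Lemma gball_subroots n m (G : rgraph m) (s : n.-tuple G) r :
  {subset s <= roots G} -> gball (RGraph s) r `<=` gball G r.
Proof. by move=> sG v [c [p [/sG cG cp pv pr]]]; exists c, p. Qed.

Lemma roots2_iso (G G' : rgraph 2) (phi : G -> G') r :
  rooted_iso (gball G r) (gball G' r) phi ->
  phi (tnth (roots G) ord0) = tnth (roots G') ord0 /\
  phi (tnth (roots G) ord_max) = tnth (roots G') ord_max.
Proof. by case=> _ _; rewrite !roots2E /= => -[-> ->]. Qed.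

Lemma gball_iso_pi1 (z z' : Gstar2) r : gball_iso r (repr z) (repr z') ->
  gball_iso r (repr (pi1 z)) (repr (pi1 z')).
Proof.
move=> [phi phir]; apply/gball_iso_repr.
apply: (reroot_gball_iso phir); rewrite /= ?(roots2_iso phir).1//.
- by apply: gball_subroots => _ /[!inE] /eqP ->; exact: mem_tnth.
- by apply: gball_subroots => _ /[!inE] /eqP ->; exact: mem_tnth.
Qed.

Lemma gball_iso_pi2 (z z' : Gstar2) r : gball_iso r (repr z) (repr z') ->
  gball_iso r (repr (pi2 z)) (repr (pi2 z')).
Proof.
move=> [phi phir]; apply/gball_iso_repr.
apply: (reroot_gball_iso phir); rewrite /= ?(roots2_iso phir).2//.
- by apply: gball_subroots => _ /[!inE] /eqP ->; exact: mem_tnth.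
- by apply: gball_subroots => _ /[!inE] /eqP ->; exact: mem_tnth.
Qed.

Lemma gball_iso_swap (z z' : Gstar2) r : gball_iso r (repr z) (repr z') ->
  gball_iso r (repr (swap z)) (repr (swap z')).
Proof.
move=> [phi phir]; apply/gball_iso_repr.
apply: (reroot_gball_iso phir).
- by rewrite /= (roots2_iso phir).1 (roots2_iso phir).2.
- by apply: gball_subroots => _ /[!inE] /orP[]/eqP ->; exact: mem_tnth.
- by apply: gball_subroots => _ /[!inE] /orP[]/eqP ->; exact: mem_tnth.
Qed.

Lemma gball_iso_adj (z z' : Gstar2) r : gball_iso r (repr z) (repr z') ->
  adj z = adj z'.
Proof.
move=> [phi phir]; rewrite /adj /root1 /root2.
have gG := gball_root r (mem_tnth _ (roots (repr z))).
have [_ phiE _] := phir.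
by rewrite -(roots2_iso phir).1 -(roots2_iso phir).2 phiE//; exact: gG.
Qed.

Lemma groot_iso (g g' : Gstar) (phi : gr g -> gr g') r :
  rooted_iso (gball (repr g) r) (gball (repr g') r) phi ->
  phi (groot g) = groot g'.
Proof.
case=> _ _; rewrite /groot; move: (roots (repr g)) (roots (repr g')) => s t.
by case/tupleP: s => a s; case/tupleP: t => b t; rewrite !theadE /= => -[].
Qed.

Lemma groot_mem (g : Gstar) : groot g \in roots (repr g).
Proof. exact: mem_tnth. Qed.

Lemma gball_groot (g : Gstar) r : gball (repr g) r (groot g).
Proof. exact/gball_root/groot_mem. Qed.

Lemma gball_rnbrs (g : Gstar) r (v : gr g) : rnbrs g v -> gball (repr g) r.+1 v.
Proof. by move=> gv; apply/gballSP; right; exists (groot g) => //; exact: gball_groot. Qed.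

(** One unit of radius is lost, since the r-ball about the root and a neighbour is only contained in
    the (r+1)-ball about the root. *)
Lemma rnbrs_iso (g g' : Gstar) (phi : gr g -> gr g') r :
  rooted_iso (gball (repr g) r.+1) (gball (repr g') r.+1) phi ->
  set_bij (rnbrs g) (rnbrs g') phi /\
  forall v, rnbrs g v -> gball_iso r
    (repr (cls2 (groot g) v)) (repr (cls2 (groot g') (phi v))).
Proof.
move=> phir; have phi0 := groot_iso phir.
have [[phiA phi_inj phi_surj] phiE _] := phir.
have phi_rnbrs v : gball (repr g) r.+1 v -> rnbrs g' (phi v) = rnbrs g v.
  by move=> gv; rewrite /rnbrs /nbrs /= -phi0 phiE//; exact: gball_groot.
have sub h (w : gr h) : rnbrs h w ->
    gball (RGraph [tuple groot h; w]) r `<=` gball (repr h) r.+1.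
  move=> hw v [c [p [+ cp pv pr]]]; rewrite !inE => /orP[]/eqP cE; subst c.
    by exists (groot h), p; split=> //; [exact: groot_mem|exact: leqW].
  exists (groot h), (w :: p); split=> //=; first exact: groot_mem.
  by rewrite cp andbT; exact: hw.
split.
- split=> [v gv|u v /set_mem gu /set_mem gv|v' gv'].
  + by rewrite phi_rnbrs//; exact: gball_rnbrs.
  + by apply: phi_inj; apply/mem_set; exact: gball_rnbrs.
  + have [v gv vE] := phi_surj _ (gball_rnbrs r gv').
    by exists v => //; rewrite -phi_rnbrs// vE.
- move=> v gv; apply/gball_iso_repr.
  apply: (reroot_gball_iso phir); [by rewrite /= phi0|exact: sub|apply: sub].
  by rewrite phi_rnbrs//; exact: gball_rnbrs.
Qed.

Lemma finite_nbrs (G : graph) (v : G) : finite_set (nbrs v).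
Proof. exact: edge_locfin. Qed.

(** * Measurability of local maps between graph spaces *)

Section measurable_graph_maps.
Context (R : realType).
Notation G1 := (BGstar R).
Notation G2 := (BGstar2 R).

(** The hypothesis is lower semicontinuity in a strong form; it makes each set {F > c} open, and the
    rays generate the Borel sets of the line. *)
Lemma measurable_lsc n (F : Gspace n -> R) :
  (forall g, exists r, forall g', gball_iso r (repr g) (repr g') -> F g <= F g') ->
  measurable_fun setT (F : g_sigma_algebraType (gopen R n) -> R).
Proof.
move=> Flsc; apply: (measurability _ (RGenOInfty.measurableE R)).
move=> _ [_ [c ->] <-]; rewrite setTI; apply: sub_sigma_algebra; apply/gopenP => g /=.
rewrite in_itv/= andbT => cg; have [r gr] := Flsc g; exists r => g' /gr.
by rewrite in_itv/= andbT; exact: lt_le_trans.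
Qed.

Lemma measurable_local n m (F : Gspace n -> Gspace m) :
  (forall r, exists r', forall g g', gball_iso r' (repr g) (repr g') ->
    gball_iso r (repr (F g)) (repr (F g'))) ->
  measurable_fun setT (F : g_sigma_algebraType (gopen R n) ->
                           g_sigma_algebraType (gopen R m)).
Proof.
move=> Floc; refine (@measurability _ _ (g_sigma_algebraType (gopen R n))
  (g_sigma_algebraType (gopen R m)) setT F (gopen R m) erefl _).
move=> _ [U /gopenP oU <-]; rewrite setTI; apply: sub_sigma_algebra.
apply/gopenP => g /= /oU[r rU]; have [r' h] := Floc r; exists r' => g' /h; exact: rU.
Qed.

Lemma measurable_pi1 : measurable_fun setT (pi1 : G2 -> G1).
Proof. by apply: measurable_local => r; exists r => z z'; exact: gball_iso_pi1. Qed.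

Lemma measurable_pi2 : measurable_fun setT (pi2 : G2 -> G1).
Proof. by apply: measurable_local => r; exists r => z z'; exact: gball_iso_pi2. Qed.

Lemma measurable_swap : measurable_fun setT (swap : G2 -> G2).
Proof. by apply: measurable_local => r; exists r => z z'; exact: gball_iso_swap. Qed.

Lemma measurable_adj : measurable_fun setT (fun z : G2 => (adj z)%:R : R).
Proof.
by apply: measurable_lsc => z; exists 0%N => z' /gball_iso_adj ->.
Qed.

End measurable_graph_maps.

(** * Sums over the neighbours of the root *)

Section neighbour_sum.
Context (R : realType).
Notation G1 := (BGstar R).
Notation G2 := (BGstar2 R).
Implicit Types F K : Gstar2 -> R.

Definition nsum F (g : Gstar) : R :=
  \sum_(v \in rnbrs g) F (cls2 (groot g) v).

Lemma eq_nsum F K g : (forall v, rnbrs g v ->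
  F (cls2 (groot g) v) = K (cls2 (groot g) v)) -> nsum F g = nsum K g.
Proof. by move=> FK; apply: eq_fsbigr => v /set_mem; exact: FK. Qed.

Lemma nsumE F g :
  nsum F g = \sum_(v <- fset_set (rnbrs g)) F (cls2 (groot g) v).
Proof. by rewrite /nsum fsbig_finite//; exact: finite_nbrs. Qed.

Lemma le_nsum F K g : (forall v, rnbrs g v ->
  F (cls2 (groot g) v) <= K (cls2 (groot g) v)) -> nsum F g <= nsum K g.
Proof.
move=> FK; rewrite !nsumE [leLHS]big_seq [leRHS]big_seq.
apply: ler_sum => v; rewrite in_fset_set; last exact: finite_nbrs.
by move/set_mem; exact: FK.
Qed.

Lemma nsum_ge0 F g : (forall v, rnbrs g v -> 0 <= F (cls2 (groot g) v)) ->
  0 <= nsum F g.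
Proof. exact: fsumr_ge0. Qed.

Lemma nsumD F K g : nsum (fun z => F z + K z) g = nsum F g + nsum K g.
Proof. by rewrite !nsumE big_split. Qed.

Lemma nsumZ (c : R) F g : nsum (fun z => c * F z) g = c * nsum F g.
Proof. by rewrite !nsumE mulr_sumr. Qed.

Lemma nsumB F K g : nsum (fun z => F z - K z) g = nsum F g - nsum K g.
Proof. by rewrite !nsumE -sumrB. Qed.

Lemma ler_norm_nsum F g : `|nsum F g| <= nsum (fun z => `|F z|) g.
Proof. by rewrite !nsumE; exact: ler_norm_sum. Qed.

Lemma cvg_nsum (f : (Gstar2 -> R)^nat) F g : (forall z, f ^~ z @ \oo --> F z) ->
  (fun n => nsum (f n) g) @ \oo --> nsum F g.
Proof.
move=> fF; rewrite nsumE (_ : (fun n => _) = (fun n =>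
    \sum_(v <- fset_set (rnbrs g)) f n (cls2 (groot g) v))); last first.
  by apply/funext => n; rewrite nsumE.
elim: (enum_fset (fset_set (rnbrs g))) => [|v s IH].
  rewrite (_ : (fun n => _) = cst 0); last by apply/funext => n; rewrite big_nil.
  by rewrite big_nil; exact: cvg_cst.
rewrite (_ : (fun n => _) = (fun n => f n (cls2 (groot g) v)) \+
  (fun n => \sum_(u <- s) f n (cls2 (groot g) u))); last first.
  by apply/funext => n; rewrite big_cons.
by rewrite big_cons; exact: cvgD (fF _) IH.
Qed.

(** Each of the finitely many neighbours counted at [g] lies in [U] because of a finite ball, so it
    is still counted at nearby [g']. A neighbour outside [U] may enter it, hence only an
    inequality. *)
Lemma nsum_indic_lsc (U : set Gstar2) : gopen R 2 U ->
  forall g, exists r, forall g', gball_iso r (repr g) (repr g') ->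
    nsum \1_U g <= nsum \1_U g'.
Proof.
move=> /gopenP oU g.
have /choice[k kP] (v : gr g) : exists k, U (cls2 (groot g) v) -> forall z',
    gball_iso k (repr (cls2 (groot g) v)) (repr z') -> U z'.
  have [/oU[k kU]|nU] := pselect (U (cls2 (groot g) v)); first by exists k.
  by exists 0%N.
(* One more than the largest radius needed, because [rnbrs_iso] loses one. *)
exists (\max_(v <- fset_set (rnbrs g)) k v).+1 => g' [phi phir].
have [phib phi2] := rnbrs_iso phir.
rewrite /nsum [leRHS](reindex_fsbig _ _ _ _ phib).
rewrite !fsbig_finite ?[leLHS]big_seq ?[leRHS]big_seq; try exact: finite_nbrs.
apply: ler_sum => v vg; have gv : rnbrs g v.
  by move: vg; rewrite in_fset_set; [move/set_mem|exact: finite_nbrs].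
rewrite !indicE ler_nat; case: (boolP (_ \in U)) => //= /set_mem Uv.
rewrite mem_set//; apply: (kP v Uv).
by apply: gball_iso_le (phi2 v gv); exact: leq_bigmax_seq.
Qed.

(** The sets with measurable neighbour sum form a lambda-system: a proper difference subtracts the
    sums, and an increasing union is a pointwise limit. The open sets form a pi-system inside it. *)
Lemma measurable_nsum_indic (A : set G2) : measurable A ->
  measurable_fun setT (nsum \1_A : G1 -> R).
Proof.
pose L := [set A : set G2 | measurable A /\ measurable_fun setT (nsum \1_A : G1 -> R)].
suff : <<s gopen R 2 >> `<=` L by move=> h /h[].
have sub_open : gopen R 2 `<=` L.
  move=> U oU; split; first exact: sub_sigma_algebra.
  exact: measurable_lsc (nsum_indic_lsc oU).
have openI : setI_closed (gopen R 2).
  move=> U V /gopenP oU /gopenP oV; apply/gopenP => z [/oU[r rU] /oV[s sV]].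
  exists (maxn r s) => z' zz'; split.
  - by apply: rU; apply: gball_iso_le zz'; exact: leq_maxl.
  - by apply: sV; apply: gball_iso_le zz'; exact: leq_maxr.
have openT : gopen R 2 setT by apply/gopenP => z _; exists 0%N.
apply: (lambda_system_subset openI) => //; split=> //.
- exact: sub_open.
- move=> B C CB [mB nB] [mC nC]; split; first exact: measurableD.
  rewrite (_ : nsum _ = (nsum \1_B \- nsum \1_C)%R); first exact: measurable_funB.
  apply/funext => g /=; rewrite -nsumB; apply: eq_nsum => v _.
  rewrite !indicE in_setD; case: (boolP (_ \in C)) => [/set_mem/CB/mem_set ->|_].
    by rewrite subrr.
  by rewrite subr0 andbT.
- move=> B ndB LB; have mB i := (LB i).1; split; first exact: bigcup_measurable.
  apply: (@measurable_fun_cvg _ G1 R _ (fun n => nsum \1_(B n))) => //.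
    by move=> n; exact: (LB n).2.
  move=> g _; apply: cvg_nsum => z; apply: cvg_near_cst.
  have [[k _ Bkz]|nBz] := pselect ((\bigcup_i B i) z).
    exists k => // i /= ki; rewrite !indicE !mem_set//; first by exists k.
    by move/subsetPset: (ndB _ _ ki); exact.
  apply: nearW => i; rewrite !indicE !memNset// => Biz; apply: nBz.
  by exists i.
Qed.

Import HBSimple.

Lemma measurable_nsum (F : G2 -> R) : measurable_fun setT F ->
  measurable_fun setT (nsum F : G1 -> R).
Proof.
move=> /measurable_EFinP mF.
have [f fF] := approximation_sfun measurableT mF.
apply: (@measurable_fun_cvg _ G1 R _ (fun n => nsum (f n))); last first.
  by move=> g _; apply: cvg_nsum => z; exact: fine_cvg (fF z I).
(* The sum of a simple function is regrouped by its finitely many values, which reduces it to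
   indicators. *)
move=> n; rewrite (_ : nsum _ = fun g => \sum_(y <- fset_set (range (f n)))
    y * nsum \1_(f n @^-1` [set y]) g); last first.
  apply/funext => g; rewrite nsumE; under eq_bigr do rewrite fimfunE fsbig_finite//.
  rewrite exchange_big /=; apply: eq_bigr => y _.
  by rewrite nsumE mulr_sumr.
apply: measurable_sum => y; apply: measurable_funM => //.
by apply: measurable_nsum_indic; rewrite -[X in measurable X]setTI; exact: measurable_funP.
Qed.

End neighbour_sum.

(** * Gradients on a Hilbert space *)

Section hilbert.
Context (R : realType) (H : hilbertType R).
Implicit Types u v w : H.

Lemma innerDr u v w : inner u (v + w) = inner u v + inner u w.
Proof. by rewrite innerC innerDl !(innerC u). Qed.

Lemma innerZr (a : R) u v : inner u (a *: v) = a * inner u v.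
Proof. by rewrite innerC innerZl (innerC u). Qed.

Lemma innerBl u v w : inner (u - v) w = inner u w - inner v w.
Proof. by rewrite innerDl -scaleN1r innerZl mulN1r. Qed.

Lemma innerBr u v w : inner u (v - w) = inner u v - inner u w.
Proof. by rewrite innerC innerBl !(innerC u). Qed.

Lemma inner0l v : inner 0 v = 0.
Proof. by rewrite -(subrr v) innerBl subrr. Qed.

Lemma inner0r v : inner v 0 = 0.
Proof. by rewrite innerC inner0l. Qed.

Lemma normD_inner u v : `|u + v| ^+ 2 = `|u| ^+ 2 + 2 * inner u v + `|v| ^+ 2.
Proof.
by rewrite -!inner_norm innerDl !innerDr (innerC v u); lra.
Qed.

Lemma inner_le u v : inner u v <= `|u| * `|v|.
Proof.
have : `|u + v| ^+ 2 <= (`|u| + `|v|) ^+ 2.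
  by rewrite ler_sqr ?nnegrE ?addr_ge0// ler_normD.
by rewrite normD_inner; lra.
Qed.

Lemma ler_norm_inner u v : `|inner u v| <= `|u| * `|v|.
Proof.
rewrite ler_norml inner_le andbT lerNl; have := inner_le (-1 *: u) v.
by rewrite innerZl mulN1r scaleN1r normrN.
Qed.

Lemma ler_norm_inner_sqr u v : `|inner u v| <= `|u| ^+ 2 + `|v| ^+ 2.
Proof.
apply: (le_trans (ler_norm_inner u v)).
have := sqr_ge0 (`|u| - `|v|); have := sqr_ge0 (`|u| + `|v|); nra.
Qed.

Lemma ler_normD_sqr u v : `|u + v| ^+ 2 <= 2 * `|u| ^+ 2 + 2 * `|v| ^+ 2.
Proof.
have : `|u + v| ^+ 2 <= (`|u| + `|v|) ^+ 2.
  by rewrite ler_sqr ?nnegrE ?addr_ge0// ler_normD.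
have := sqr_ge0 (`|u| - `|v|); nra.
Qed.

Lemma inner_inj u v : (forall w, inner u w = inner v w) -> u = v.
Proof.
move=> uv; apply/eqP; rewrite -subr_eq0 -normr_eq0 -sqrf_eq0 -inner_norm.
by rewrite innerBl uv subrr.
Qed.

Lemma is_gradient_unique (F : H -> R) a u v :
  is_gradient setT (@inner _ _) F a u -> is_gradient setT (@inner _ _) F a v ->
  u = v.
Proof.
move=> [_ Fu] [_ Fv]; apply: inner_inj => w.
exact: cvg_unique (Fu w I) (Fv w I).
Qed.

Lemma gradE (F : H -> R) a u : is_gradient setT (@inner _ _) F a u -> grad F a = u.
Proof.
move=> Fu; rewrite /gradient; case: xgetP => [v _ Fv|/(_ u)//].
exact: is_gradient_unique Fv Fu.
Qed.

Lemma gradP (F : H -> R) a : gdiffH F a ->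
  is_gradient setT (@inner _ _) F a (grad F a).
Proof. by move=> [u Fu]; rewrite (gradE Fu). Qed.

(** The one-variable mean value theorem for s |-> F(a + s w) on [0, 1], whose derivative is the
    directional derivative along w. A general pairing [ip] lets the lemma serve both [H] and
    [H * H]. *)
Lemma gradient_mvt (V : lmodType R) (D : set V) (ip : V -> V -> R) (F : V -> R)
    (G : V -> V) (a w : V) : D w ->
  (forall s : R, is_gradient D ip F (a + s *: w) (G (a + s *: w))) ->
  exists2 s : R, 0 <= s <= 1 & F (a + w) - F a = ip (G (a + s *: w)) w.
Proof.
move=> Dw FG; pose k (s : R) : R := F (a + s *: w).
have kd (s : R) : is_derive s 1 k (ip (G (a + s *: w)) w).
  have kcvg : h^-1 *: (k (h *: 1 + s) - k s) @[h --> (0 : R)^'] -->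
      ip (G (a + s *: w)) w.
    rewrite (_ : (fun h => _) = (fun h : R =>
      h^-1 * (F (a + s *: w + h *: w) - F (a + s *: w)))); first exact: (FG s).2.
    apply/funext => h; rewrite /k /= -addrA -scalerDl.
    by rewrite [h *: 1]mulr1 (addrC s).
  split; first by apply/cvg_ex; eexists; exact: kcvg.
  exact: (cvg_lim _ kcvg).
have kc : {within `[0, 1], continuous k}.
  by apply: derivable_within_continuous => s _; case: (kd s).
have [s s01] := @MVT R k _ 0 1 ltr01 (fun s _ => kd s) kc.
rewrite subr0 mulr1 /k scale1r scale0r addr0 => ->; exists s => //.
by move: s01; rewrite in_itv/= => /andP[/ltW -> /ltW ->].
Qed.

Lemma grad_mvt (F : H -> R) a w : (forall b, gdiffH F b) ->
  exists2 s : R, 0 <= s <= 1 & F (a + w) - F a = inner (grad F (a + s *: w)) w.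
Proof. by move=> dF; apply: (@gradient_mvt _ setT) => // s; exact: gradP. Qed.

(** Testing the joint gradient on directions (v, 0) and (0, v) gives the partial ones. *)
Lemma is_gradient2 (k : H -> H -> R) (a b : H) (p : H * H) :
  is_gradient setT (@inner2 _ _) (fun q => k q.1 q.2) (a, b) p ->
  p = (grad1 k a b, grad2 k a b).
Proof.
move=> [_ kp]; rewrite [LHS]surjective_pairing; congr (_, _).
- apply/esym/gradE; split=> // v _; rewrite (_ : (fun h => _) = (fun h : R =>
    h^-1 * (k ((a, b) + h *: (v, 0)).1 ((a, b) + h *: (v, 0)).2 - k a b))).
    by have := kp (v, 0) I; rewrite /inner2 /= inner0r addr0.
  by apply/funext => h /=; rewrite scaler0 addr0.
- apply/esym/gradE; split=> // v _; rewrite (_ : (fun h => _) = (fun h : R =>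
    h^-1 * (k ((a, b) + h *: (0, v)).1 ((a, b) + h *: (0, v)).2 - k a b))).
    by have := kp (0, v) I; rewrite /inner2 /= inner0r add0r.
  by apply/funext => h /=; rewrite scaler0 addr0.
Qed.

Lemma grad2_mvt (k : H -> H -> R) (a b v w : H) :
  (forall p : H * H, gdiffHH (fun q => k q.1 q.2) p) ->
  exists2 s : R, 0 <= s <= 1 & k (a + v) (b + w) - k a b =
    inner (grad1 k (a + s *: v) (b + s *: w)) v +
    inner (grad2 k (a + s *: v) (b + s *: w)) w.
Proof.
move=> dk.
have := @gradient_mvt (H * H)%type setT (@inner2 _ _) (fun q => k q.1 q.2)
  (fun p => (grad1 k p.1 p.2, grad2 k p.1 p.2)) (a, b) (v, w) I.
case=> [s|s s01 E]; last by exists s.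
by have [p /[dup] kp /is_gradient2 <-] := dk ((a, b) + s *: (v, w)).
Qed.

End hilbert.

(** * Measurability in a separable Hilbert space *)

Section hilbert_measurable.
Context (R : realType) (H : hilbertType R) (sepH : separable_space H).
Context d (T : measurableType d).
Notation mfun f := (measurable_fun setT (f : T -> Borel H)).

Lemma separable_approx : exists S : nat -> H,
  forall (a : H) (e : R), 0 < e -> exists i, `|a - S i| < e.
Proof.
have [S cS dS] := sepH.
have SP (a : H) (e : R) : 0 < e -> exists2 s, S s & `|a - s| < e.
  move=> e0; have /(_ _ _)[||s [/= sa Ss]] := dS (ball a e); last first.
  - by exists s => //; move: sa; rewrite -ball_normE.
  - exact: ball_open.
  - by exists a; exact: ballxx.
(* A countable set is empty or enumerated by the naturals; a dense set is not empty, as it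
   approximates 0. *)
have /pfcard_geP[S0|[f]] := cS.
  by have [s] := SP 0 1 ltr01; rewrite S0.
exists f => a e /(SP a)[s Ss ase].
by have [i _ iE] := @surj _ _ _ _ f _ Ss; exists i; rewrite iE.
Qed.

(** By separability an open set is the countable union of the balls of radius 1/(n+1) about the
    points [S i] that it contains. Radii below e/2 are used, so that such a ball around a point
    stays within distance e of it. *)
Lemma measurable_norm_sub (f : T -> H) :
  (forall c, measurable_fun setT (fun x => `|f x - c|)) -> mfun f.
Proof.
move=> mf; have [S SP] := separable_approx.
apply: (@measurability _ _ T (Borel H) setT f open erefl) => _ [U oU <-].
rewrite setTI.
have -> : f @^-1` U = \bigcup_i \bigcup_(n in
    [set n | forall a, `|a - S i| < n.+1%:R^-1 -> U a])
    ((fun x => `|f x - S i|) @^-1` `]-oo, n.+1%:R^-1[%classic).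
  apply/seteqP; split=> [x /= Ux|x [i _ [n /= nU]]]; last first.
    by rewrite in_itv/=; exact: nU.
  have /nbhs_ballP[e /= e0 eU] := open_nbhs_nbhs (conj oU Ux).
  have e20 : 0 < e / 2 by rewrite divr_gt0.
  have [n _ /(_ n (leqnn n))/= ne] := near_infty_natSinv_lt (PosNum e20).
  have [i iP] := SP (f x) n.+1%:R^-1 (ltac:(by rewrite invr_gt0 ltr0n)).
  exists i => //; exists n => /=; last by rewrite in_itv.
  move=> a ai; apply: eU; rewrite -ball_normE /ball_ /= (splitr e).
  rewrite -(subrKA (S i)); apply: (le_lt_trans (ler_normD _ _)).
  by rewrite ltrD// ?(distrC (S i)); apply: lt_trans ne.
apply: bigcup_measurable => i _; apply: bigcup_measurable => n _.
by rewrite -[X in measurable X]setTI; exact: mf.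
Qed.

(** Separability again: an open set of the product is a countable union of products of balls. This
    makes sums and inner products of measurable functions measurable. *)
Lemma measurable_open2 (f g : T -> H) (W : set (H * H)) : mfun f -> mfun g ->
  open W -> measurable [set x | W (f x, g x)].
Proof.
move=> mf mg oW; have [S SP] := separable_approx.
have mball (k : T -> H) c r : 0 < r -> mfun k -> measurable [set x | `|k x - c| < r].
  move=> r0 mk; rewrite -[X in measurable X]setTI.
  apply: (mk measurableT [set a | `|a - c| < r]); apply: sub_sigma_algebra.
  rewrite (_ : [set a | _] = ball c r); first exact: ball_open.
  by rewrite -ball_normE; apply/seteqP; split=> a /=; rewrite distrC.
have -> : [set x | W (f x, g x)] = \bigcup_i \bigcup_j \bigcup_(n in
    [set n | forall a b, `|a - S i| < n.+1%:R^-1 -> `|b - S j| < n.+1%:R^-1 ->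
      W (a, b)])
    ([set x | `|f x - S i| < n.+1%:R^-1] `&` [set x | `|g x - S j| < n.+1%:R^-1]).
  apply/seteqP; split=> [x /= Wx|x [i _ [j _ [n /= nW [fi gj]]]]]; last exact: nW.
  have /nbhs_ballP[e /= e0 eW] := open_nbhs_nbhs (conj oW Wx).
  have e20 : 0 < e / 2 by rewrite divr_gt0.
  have [n _ /(_ n (leqnn n))/= ne] := near_infty_natSinv_lt (PosNum e20).
  have n0 : 0 < n.+1%:R^-1 :> R by rewrite invr_gt0 ltr0n.
  have [[i iP] [j jP]] := (SP (f x) _ n0, SP (g x) _ n0).
  exists i => //; exists j => //; exists n => //= a b ai bj; apply: eW.
  split; rewrite -ball_normE /ball_ /= (splitr e).
  - rewrite -(subrKA (S i)); apply: (le_lt_trans (ler_normD _ _)).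
    by rewrite ltrD// ?(distrC (S i)); apply: lt_trans ne.
  - rewrite -(subrKA (S j)); apply: (le_lt_trans (ler_normD _ _)).
    by rewrite ltrD// ?(distrC (S j)); apply: lt_trans ne.
apply: bigcup_measurable => i _; apply: bigcup_measurable => j _.
by apply: bigcup_measurable => n _; apply: measurableI; apply: mball => //;
  rewrite invr_gt0 ltr0n.
Qed.

Lemma measurable_cont2 (f g : T -> H) (k : H * H -> R) : mfun f -> mfun g ->
  continuous k -> measurable_fun setT (fun x => k (f x, g x)).
Proof.
move=> mf mg /continuousP ck; apply: (measurability _ (RGenOInfty.measurableE R)).
move=> _ [_ [c ->] <-]; rewrite setTI.
by apply: (measurable_open2 mf mg (W := k @^-1` `]c, +oo[%classic)); exact: ck.
Qed.

Lemma measurable_normH (f : T -> H) : mfun f -> measurable_fun setT (fun x => `|f x|).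
Proof.
move=> mf; apply: (measurable_cont2 (k := fun p => `|p.1|) mf mf) => p.
by apply: cvg_norm; exact: cvg_fst.
Qed.

Lemma measurable_addZH (f g : T -> H) (t : R) : mfun f -> mfun g ->
  mfun (fun x => f x + t *: g x).
Proof.
move=> mf mg; apply: measurable_norm_sub => c.
apply: (measurable_cont2 (k := fun p => `|p.1 + t *: p.2 - c|) mf mg) => p.
apply: cvg_norm; apply: cvgB; last exact: cvg_cst.
by apply: cvgD; [exact: cvg_fst|apply: cvgZl_tmp; exact: cvg_snd].
Qed.

Lemma measurable_innerH (f g : T -> H) : mfun f -> mfun g ->
  measurable_fun setT (fun x => inner (f x) (g x)).
Proof.
move=> mf mg.
(* Polarization, with the factor [1 *:] matching the form of [measurable_addZH]. *)
rewrite (_ : (fun x => _) = (fun x =>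
  2^-1 * (`|f x + 1 *: g x| ^+ 2 - `|f x| ^+ 2 - `|g x| ^+ 2))).
  apply: measurable_funM => //; apply: measurable_funB; first apply: measurable_funB.
  - by apply: measurable_funX; apply: measurable_normH; exact: measurable_addZH.
  - by apply: measurable_funX; exact: measurable_normH.
  - by apply: measurable_funX; exact: measurable_normH.
by apply/funext => x; rewrite scale1r normD_inner; lra.
Qed.

Lemma measurable_weak (f : T -> H) :
  (forall v, measurable_fun setT (fun x => inner (f x) v)) -> mfun f.
Proof.
move=> mf; apply: measurable_norm_sub => c; have [S SP] := separable_approx.
apply: (measurability _ (RGenOInfty.measurableE R)).
move=> _ [_ [r ->] <-]; rewrite setTI.
have [r0|r0] := ltP r 0.
  rewrite (_ : _ @^-1` _ = setT); first exact: measurableT.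
  by apply/seteqP; split=> // x _ /=; rewrite in_itv/= andbT (lt_le_trans r0).
(* |u| <= r as soon as <u, s> <= r |s| for all s in a dense set *)
have -> : (fun x => `|f x - c|) @^-1` `]r, +oo[%classic =
    ~` (\bigcap_i [set x | inner (f x) (S i) - inner c (S i) <= r * `|S i|]).
  apply/seteqP; split=> x /=; rewrite in_itv/= andbT.
  - move=> ru fle; set u := f x - c in ru; have u0 := le_lt_trans r0 ru.
    (* From <u, s> <= r |s| one gets |u| (|u| - r) <= (|u| + r) |u - s|. This radius makes the right
       side less than half of the left, a contradiction. *)
    have e0 : 0 < `|u| * (`|u| - r) / (2 * (`|u| + r)).
      by rewrite divr_gt0 ?mulr_gt0 ?subr_gt0// ltr_wpDr.
    have [i] := SP u _ e0; set e := _ / _ in e0 *; set s := S i => ue.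
    have eE : e * (2 * (`|u| + r)) = `|u| * (`|u| - r).
      by rewrite /e mulfVK// gt_eqF// mulr_gt0// ltr_wpDr.
    have us : inner u s <= r * `|s| by rewrite innerBl; exact: (fle i).
    have := ler_norm_inner u (u - s); rewrite ler_norml => /andP[_].
    rewrite innerBr inner_norm => h1.
    have h2 : `|s| <= `|u| + `|u - s| by rewrite -{1}(subKr u s) ler_normB.
    have h3 := ler_wpM2l r0 h2.
    have h4 : `|u - s| * (`|u| + r) < e * (`|u| + r) by rewrite ltr_pM2r// ltr_wpDr.
    have h5 : 0 < `|u| * (`|u| - r) by rewrite mulr_gt0// subr_gt0.
    suff : `|u| * (`|u| - r) <= 0 by rewrite leNgt h5.
    lra.
  - move=> nb; rewrite ltNge; apply/negP => xr; apply: nb => i _ /=; rewrite -innerBl.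
    by apply: (le_trans (inner_le _ _)); exact: ler_wpM2r.
apply: measurableC; apply: bigcap_measurableType => i _.
rewrite -[X in measurable X]setTI.
have := measurable_funB (mf (S i)) (@measurable_cst _ _ T _ setT (inner c (S i))).
move=> /(_ measurableT `]-oo, (r * `|S i|)]%classic (measurable_itv _)).
by congr (measurable (_ `&` _)); apply/seteqP; split=> x /=; rewrite in_itv.
Qed.

End hilbert_measurable.

(** * Null sets and mass transport *)

(* Integrals of possibly nonmeasurable functions: gradients are arbitrary on
   the exceptional null set. *)
Section null_sets.
Context d (T : measurableType d) (R : realType) (mu : {measure set T -> \bar R}).
Variables (N : set T) (mN : measurable N) (muN : mu N = 0%E).
Import HBNNSimple.

(** Neither function is assumed measurable, so the proof returns to the supremum over simple
    functions: cutting one off on [N] leaves its integral unchanged and puts it below the other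
    function. *)
Lemma eq_integral_off_null (f g : T -> \bar R) : (forall x, ~ N x -> f x = g x) ->
  (\int[mu]_x f x = \int[mu]_x g x)%E.
Proof.
suff le0 (k l : T -> \bar R) : (forall x, 0 <= k x)%E -> (forall x, 0 <= l x)%E ->
    (forall x, ~ N x -> k x = l x) -> (\int[mu]_x k x <= \int[mu]_x l x)%E.
  move=> fg; rewrite integralE [RHS]integralE.
  have fgN x : ~ N x -> (f^\+ x = g^\+ x)%E /\ (f^\- x = g^\- x)%E.
    by move=> /fg fgx; rewrite !funeposE !funenegE fgx.
  congr (_ - _)%E; apply/eqP; rewrite eq_le !le0//= => x /fgN[]//.
move=> k0 l0 kl; rewrite (ge0_integralTE _ k0) (ge0_integralTE _ l0).
apply: ge_ereal_sup => _ [s /= sk <-].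
have mNC : measurable (~` N) by exact: measurableC.
have [s' s'E] : exists s' : {nnsfun T >-> R},
    forall x, s' x = s x * (x \in ~` N)%:R.
  by exists (mul_nnsfun s (indic_nnsfun R mNC)) => x; rewrite /= mindicE.
rewrite (_ : sintegral mu s = sintegral mu s').
  apply: ereal_sup_ubound; exists s' => // x /=; rewrite s'E.
  have [Nx|Nx] := pselect (N x); last by rewrite mem_set// mulr1 -kl.
  by rewrite memNset ?mulr0//= => /(_ Nx).
rewrite -!integralT_nnsfun; apply: ge0_ae_eq_integral => //.
- exact/measurable_EFinP.
- exact/measurable_EFinP.
- by move=> x _; rewrite lee_fin.
- by move=> x _; rewrite lee_fin.
exists N; split=> // x /= /not_implyP[_ H]; apply: contrapT => Nx; apply: H.
by rewrite s'E mem_set// mulr1.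
Qed.

Lemma le_integrable_off_null (F K : T -> R) : measurable_fun setT F ->
  mu.-integrable setT (EFin \o K) -> (forall x, ~ N x -> `|F x| <= K x) ->
  mu.-integrable setT (EFin \o F).
Proof.
move=> mF iK FK; have mFE : measurable_fun setT (EFin \o F) by exact/measurable_EFinP.
(* The domination may fail on [N], so it is applied to [F] set to 0 there. *)
apply/integrableP; split=> //; pose F' x := F x * \1_(~` N) x.
have F'N x : ~ N x -> F' x = F x by move=> Nx; rewrite /F' indicE mem_set// mulr1.
rewrite (@eq_integral_off_null _ (fun x => `|(F' x)%:E|%E)); last first.
  by move=> x Nx /=; rewrite F'N.
have mF' : measurable_fun setT F'.
  by apply: measurable_funM => //; apply: measurable_indic; exact: measurableC.
suff /integrableP[] : mu.-integrable setT (EFin \o F') by [].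
apply: le_integrable iK => //; first exact/measurable_EFinP.
move=> x _ /=; rewrite lee_fin; have [Nx|Nx] := pselect (N x).
  by rewrite /F' indicE memNset ?mulr0 ?normr0//= => /(_ Nx).
by rewrite F'N//; apply: (le_trans (FK _ Nx)); exact: ler_norm.
Qed.

Lemma le_Rintegral_off_null (F K : T -> R) : mu.-integrable setT (EFin \o F) ->
  mu.-integrable setT (EFin \o K) -> (forall x, ~ N x -> `|F x| <= K x) ->
  `|\int[mu]_x F x| <= \int[mu]_x K x.
Proof.
move=> iF iK FK; pose E : T -> R := \1_(~` N).
have E1 x : ~ N x -> E x = 1 by move=> Nx; rewrite /E indicE mem_set.
have E0 x : N x -> E x = 0 by move=> Nx; rewrite /E indicE memNset//= => /(_ Nx).
have mE : measurable_fun setT E by apply: measurable_indic; exact: measurableC.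
have cut (L : T -> R) : mu.-integrable setT (EFin \o L) ->
    mu.-integrable setT (EFin \o (fun x => E x * L x)) /\
    \int[mu]_x L x = \int[mu]_x (E x * L x).
  move=> iL; split; last first.
    by congr fine; apply: eq_integral_off_null => x Nx; rewrite E1// mul1r.
  have mL : measurable_fun setT L by case/integrableP : iL => /measurable_EFinP.
  apply: (le_integrable _ _ _ iL) => //.
    by apply/measurable_EFinP; exact: measurable_funM.
  move=> x _ /=; rewrite lee_fin normrM; have [Nx|Nx] := pselect (N x).
    by rewrite E0// normr0 mul0r.
  by rewrite E1// normr1 mul1r.
have [[iF' ->] [iK' ->]] := (cut F iF, cut K iK).
apply: (le_trans (le_normr_Rintegral _ iF')) => //.
apply: le_Rintegral => //.
  apply: (le_integrable _ _ _ iF') => //; last by move=> x _; rewrite /= normr_id.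
  case/integrableP : iF' => /measurable_EFinP mF' _.
  by apply/measurable_EFinP; exact: measurableT_comp mF'.
move=> x _; rewrite normrM; have [Nx|Nx] := pselect (N x).
  by rewrite E0// normr0 !mul0r.
by rewrite E1// normr1 !mul1r; exact: FK.
Qed.

End null_sets.

Section real_integrable.
Context d (T : measurableType d) (R : realType) (mu : {measure set T -> \bar R}).
Notation rint F := (mu.-integrable setT (EFin \o (F : T -> R))).

Lemma rintD (F K : T -> R) : rint F -> rint K -> rint (fun x => F x + K x).
Proof. by move=> iF iK; exact: (integrableD measurableT iF iK). Qed.

Lemma rintZ (c : R) (F : T -> R) : rint F -> rint (fun x => c * F x).
Proof. by move=> iF; exact: (integrableZl measurableT c iF). Qed.

Lemma rintB (F K : T -> R) : rint F -> rint K -> rint (fun x => F x - K x).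
Proof. by move=> iF iK; exact: (integrableB measurableT iF iK). Qed.

Lemma rint_measurable (F : T -> R) : rint F -> measurable_fun setT F.
Proof. by move=> /integrableP[/measurable_EFinP]. Qed.

End real_integrable.

Lemma pi1_swap z : pi1 (swap z) = pi2 z.
Proof. exact: pi1_cls2. Qed.

Lemma pi2_swap z : pi2 (swap z) = pi1 z.
Proof. exact: pi2_cls2. Qed.

Lemma cls2_roots z : cls2 (root1 z) (root2 z) = z.
Proof.
rewrite -[RHS]reprK /cls2 /root1 /root2; case: (repr z) => G t /=.
by congr (\pi _)%qT; congr RGraph; apply: val_inj; case: t => -[|a [|b []]].
Qed.

Lemma adj_swap z : adj (swap z) = adj z.
Proof. by rewrite /swap adj_cls2 edge_sym. Qed.

Lemma adj_rnbrs z : adj z ->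
  exists2 v, rnbrs (pi1 z) v & z = cls2 (groot (pi1 z)) v.
Proof.
rewrite /adj edge_sym => /rnbrs_cls1[w zw E]; exists w => //.
by rewrite E cls2_roots.
Qed.

(** * Mass transport along edges *)

Section mass_transport.
Context (R : realType) (mu : probability (BGstar R) R).
Hypothesis mu_unimodular : unimodular mu.
Notation G1 := (BGstar R).
Notation G2 := (BGstar2 R).

(** Unimodularity sums over all vertices; the weight [adj] reduces that sum to the neighbours of the
    root. *)
Lemma esum_nsum (F : Gstar2 -> R) (g : Gstar) : (forall z, 0 <= F z) ->
  (\esum_(v in [set: gr g])
      ((adj (cls2 (groot g) v))%:R * F (cls2 (groot g) v))%:E)%E = (nsum F g)%:E.
Proof.
move=> F0; rewrite /nsum -fsumEFin; last exact: finite_nbrs.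
rewrite -esum_fset; [|exact: finite_nbrs|by move=> v _; rewrite lee_fin].
rewrite [RHS]esum_mkcond; apply: eq_esum => v _; rewrite adj_cls2.
case: ifPn => [/set_mem gv|]; first by rewrite (gv : edge _ _) mul1r.
by rewrite notin_setE => /negP/negbTE gv; rewrite (gv : edge _ _ = false) mul0r.
Qed.

(** Unimodularity for T = [adj] * F; adjacency is symmetric, so exchanging the roots affects only
    F. *)
Lemma mass_transport (F : Gstar2 -> R) : measurable_fun setT (F : G2 -> R) ->
  (forall z, 0 <= F z) ->
  (\int[mu]_g (nsum F g)%:E = \int[mu]_g (nsum (F \o swap) g)%:E)%E.
Proof.
move=> mF F0; pose Fa z : \bar R := ((adj z)%:R * F z)%:E.
have := mu_unimodular (T := Fa).
under eq_integral do rewrite esum_nsum//.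
move=> ->.
- apply: eq_integral => g _; rewrite -esum_nsum//=.
  apply: eq_esum => v _; rewrite /Fa -(swap_cls2 (groot g) v) adj_swap.
  by [].
- by apply/measurable_EFinP; apply: measurable_funM => //; exact: measurable_adj.
- by move=> z; rewrite lee_fin mulr_ge0.
Qed.

(** Signed mass transport. For nonnegative functions transport preserves finiteness of the integral,
    hence integrability; the equality follows by applying it to the positive and negative parts. *)
Lemma rint_swap (F : Gstar2 -> R) : measurable_fun setT (F : G2 -> R) ->
  mu.-integrable setT (EFin \o nsum (fun z => `|F z|)) ->
  [/\ mu.-integrable setT (EFin \o nsum F),
      mu.-integrable setT (EFin \o nsum (F \o swap)),
      mu.-integrable setT (EFin \o nsum (fun z => `|F (swap z)|)) &
      \int[mu]_g nsum F g = \int[mu]_g nsum (F \o swap) g].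
Proof.
move=> mF iF.
have mFs : measurable_fun setT (F \o swap : G2 -> R).
  exact: (measurableT_comp mF (@measurable_swap R)).
have dom (K L : Gstar2 -> R) : measurable_fun setT (K : G2 -> R) ->
    (forall z, `|K z| <= L z) ->
    mu.-integrable setT (EFin \o nsum L) -> mu.-integrable setT (EFin \o nsum K).
  move=> mK KL; apply: le_integrable => //.
    by apply/measurable_EFinP; exact: measurable_nsum.
  move=> g _; rewrite /= lee_fin (le_trans (ler_norm_nsum _ _))//.
  by rewrite (le_trans _ (ler_norm _))//; apply: le_nsum => v _; exact: KL.
have swap_abs (K : Gstar2 -> R) : measurable_fun setT (K : G2 -> R) ->
    (forall z, 0 <= K z) -> mu.-integrable setT (EFin \o nsum K) ->
    mu.-integrable setT (EFin \o nsum (K \o swap)).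
  move=> mK K0 /integrableP[_ iK]; apply/integrableP; split.
    apply/measurable_EFinP; apply: measurable_nsum.
    exact: (measurableT_comp mK (@measurable_swap R)).
  have absE (L : Gstar2 -> R) : (forall z, 0 <= L z) ->
      (fun g => `|(EFin \o nsum L) g|%E) = (fun g => (nsum L g)%:E).
    by move=> L0; apply/funext => g; rewrite /= ger0_norm//; exact: nsum_ge0.
  by move: iK; rewrite absE// mass_transport// absE// => z; exact: K0.
have mabs : measurable_fun setT ((fun z => `|F z|) : G2 -> R).
  exact: measurableT_comp mF.
have iFs : mu.-integrable setT (EFin \o nsum (fun z => `|F (swap z)|)).
  by apply: (swap_abs (fun z => `|F z|)).
split=> //; [exact: dom iF|exact: dom iFs|].
have mp : measurable_fun setT (F^\+%R : G2 -> R) by exact: measurable_funrpos.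
have mn : measurable_fun setT (F^\-%R : G2 -> R) by exact: measurable_funrneg.
have absE z : `|F z| = F^\+ z + F^\- z by rewrite -[LHS]/((Num.norm \o F) z) -funrposDneg.
have ip : mu.-integrable setT (EFin \o nsum F^\+%R).
  by apply: dom iF => // z; rewrite ger0_norm// absE lerDl.
have im : mu.-integrable setT (EFin \o nsum F^\-%R).
  by apply: dom iF => // z; rewrite ger0_norm// absE lerDr.
have E (K : Gstar2 -> R) g : nsum K g = nsum K^\+%R g - nsum K^\-%R g.
  by rewrite -nsumB; apply: eq_nsum => v _; rewrite -[in LHS](funrposBneg K).
under eq_Rintegral do rewrite E.
under [RHS]eq_Rintegral do rewrite E.
rewrite !RintegralB//.
- by congr (_ - _); rewrite /Rintegral mass_transport.
- exact: (swap_abs F^\+%R).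
- exact: (swap_abs F^\-%R).
Qed.

End mass_transport.

(** By mass transport, the expected number of neighbours in [N] is the integral of the degree of the
    root over [N], which is 0. So almost surely there are none. *)
Lemma null_neighbours (R : realType) (mu : probability (BGstar R) R) (N : set (BGstar R)) :
  unimodular mu -> measurable N -> mu N = 0%E ->
  exists N' : set (BGstar R), [/\ measurable N', mu N' = 0%E, N `<=` N' &
    forall g, ~ N' g -> forall v, rnbrs g v -> ~ N (cls1 v)].
Proof.
move=> unimu mN muN; pose F (z : Gstar2) : R := \1_N (pi2 z).
have mF : measurable_fun setT (F : BGstar2 R -> R).
  apply: (measurableT_comp (f := \1_N : BGstar R -> R)); last exact: measurable_pi2.
  exact: measurable_indic.
have F0 z : 0 <= F z by rewrite /F indicE ler0n.
have iF : (\int[mu]_g (nsum F g)%:E = 0)%E.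
  rewrite mass_transport// -[RHS](integral0 mu setT).
  apply: (eq_integral_off_null mN muN) => g Ng; congr (_%:E).
  rewrite /nsum fsbig1// => v _; rewrite /F /= swap_cls2 pi2_cls2 cls1_groot.
  by rewrite indicE memNset.
have mS : measurable_fun setT (EFin \o (nsum F : BGstar R -> R)).
  by apply/measurable_EFinP; exact: measurable_nsum.
have S0 g : 0 <= nsum F g by apply: nsum_ge0.
have [M [mM muM MP]] : ae_eq mu setT (EFin \o nsum F) (cst 0%E).
  apply/(ae_eq_integral_abs mu measurableT mS); rewrite -[RHS]iF.
  by apply: eq_integral => g _; rewrite /= ger0_norm.
exists (N `|` M); split.
- exact: measurableU.
- by rewrite measureU0.
- by left.
move=> g /not_orP[Ng Mg] v gv Nv; apply: Mg; apply: MP => SF0.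
have : nsum F g = 0 by apply: EFin_inj; exact: SF0.
move=> /(pfsumr_eq0 (finite_nbrs _) (fun v _ => F0 _)) /(_ v gv).
by rewrite /F pi2_cls2 indicE mem_set// => /eqP; rewrite oner_eq0.
Qed.

(** * Null sets outside which the hypotheses hold *)

Section good.
Context (R : realType) (H : hilbertType R).
Implicit Types (h psi : Gstar2 -> H -> H -> R) (f : Gstar -> H -> R).

(** Phrased for a class in [Gstar2] rather than for a root and its neighbour, so that it applies to
    [swap z] as well. *)
Definition good_edge h psi (Lh : R) (z : Gstar2) : Prop :=
  [/\ forall a b : H, gdiffH (fun a' => h z a' b) a,
      forall p : H * H, gdiffHH (fun q => psi z q.1 q.2) p,
      forall a b : H, grad1 (psi z) a b = grad1 (h z) a b /\
                      grad2 (psi z) a b = grad1 (h (swap z)) b a &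
      forall a a' b b' : H, `|grad1 (h z) a b - grad1 (h z) a' b'|
        <= Lh * (`|a - a'| + `|b - b'|)].

Definition good_root f (Lf : R) (D : nat) (g : Gstar) : Prop :=
  [/\ forall a : H, gdiffH (f g) a,
      forall a a' : H, `|grad (f g) a - grad (f g) a'| <= Lf * `|a - a'| &
      forall v : gr g, (deg v <= D)%N].

(** Off [N0] the root and its outgoing edges are good. Off the larger null set [N] the neighbours
    avoid [N0] too, so the reversed edges are also good, as the gradient of psi in its second
    argument requires. *)
Lemma admissible_good (mu : probability (BGstar R) R) f h psi :
  unimodular mu -> bounded_degree mu -> admissible mu f h psi ->
  exists (Lf Lh : R) (D : nat) (N0 N : set (BGstar R)),
    [/\ 0 <= Lf, 0 <= Lh,
      [/\ measurable N0, mu N0 = 0%E, measurable N, mu N = 0%E & N0 `<=` N],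
      forall g, ~ N0 g -> good_root f Lf D g &
      (forall z, adj z -> ~ N0 (pi1 z) -> good_edge h psi Lh z) /\
      forall g, ~ N g -> forall v, rnbrs g v -> ~ N0 (cls1 v)].
Proof.
move=> unimu [D degD] [_ _ _ df dh [Lf [Lh [Lf0 Lh0 lf lh]]] _].
have [N0 [mN0 muN0 N0P]] : \forall g \ae mu, (good_root f Lf D g /\
    forall v, rnbrs g v -> good_edge h psi Lh (cls2 (groot g) v)).
  have FF := ae_filter_ringOfSetsType mu; have fI := @filterI _ _ FF.
  apply: (@filterS _ _ FF) (fI _ _ (fI _ _ df degD) (fI _ _ lf (fI _ _ dh lh))).
  move=> g [[dfg degg] [lfg [dhg lhg]]]; split=> // v gv.
  by have [dh1 dpsi gh] := dhg v gv; split=> //; [rewrite swap_cls2|exact: lhg].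
have [N [mN muN N0N NP]] := null_neighbours unimu mN0 muN0.
exists Lf, Lh, D, N0, N; split=> //.
- by move=> g Ng; apply: contrapT => ngood; apply: Ng; apply: N0P => -[].
- split=> // z /adj_rnbrs[v gv zE] Nz; apply: contrapT => ngood; apply: Nz.
  by apply: N0P => -[_ /(_ v gv)]; rewrite -zE.
Qed.

End good.

(** * The potential functional *)

(** Difference quotients along 1/(n+1): a sequential limit is what measurability of gradients calls
    for. *)
Lemma gradient_cvg_seq (R : realType) (V : lmodType R) (D : set V)
    (ip : V -> V -> R) (F : V -> R) (a u v : V) :
  is_gradient D ip F a u -> D v ->
  (fun n : nat => n.+1%:R * (F (a + n.+1%:R^-1 *: v) - F a)) @ \oo --> ip u v.
Proof.
move=> [_ Fu] Dv; have h0 : (fun n : nat => n.+1%:R^-1 : R) @ \oo --> (0 : R)^'.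
  move=> A [e /= e0 eA].
  have [n _ nP] := near_infty_natSinv_lt (PosNum e0); exists n => // m /= nm.
  apply: eA => /=; last by rewrite invr_eq0 pnatr_eq0.
  by rewrite sub0r normrN ger0_norm ?invr_ge0//; exact: nP.
rewrite (_ : (fun n : nat => _) = (fun s => s^-1 * (F (a + s *: v) - F a)) \o
  (fun n : nat => n.+1%:R^-1)); last by apply/funext => n /=; rewrite invrK.
exact: (cvg_comp _ _ h0 (Fu v Dv)).
Qed.

(** * Square-integrable functions *)

Section L2_space.
Context (R : realType) (H : hilbertType R) (sepH : separable_space H).
Context (mu : probability (BGstar R) R).
Notation rint F := (mu.-integrable setT (EFin \o (F : BGstar R -> R))).

Lemma L2P (x : Gstar -> H) : L2 mu H x <->
  measurable_fun setT (x : BGstar R -> Borel H) /\ rint (fun g => `|x g| ^+ 2).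
Proof.
split=> -[mx ix]; split=> //.
- apply/integrableP; split.
    by apply/measurable_EFinP; apply: measurable_funX; exact: measurable_normH.
  rewrite (_ : (fun g => _) = (fun g => (`|x g| ^+ 2)%:E))//.
  by apply/funext => g; rewrite /= ger0_norm// exprn_ge0.
- move/integrableP : ix => [_].
  rewrite (_ : (fun g => `|_|%E) = (fun g => (`|x g| ^+ 2)%:E))//.
  by apply/funext => g; rewrite /= ger0_norm// exprn_ge0.
Qed.

Lemma rint_cst (a : R) : rint (fun=> a).
Proof. exact: finite_measure_integrable_cst. Qed.

Lemma L2_cst (a : H) : L2 mu H (fun=> a).
Proof. by apply/L2P; split; [exact: measurable_cst|exact: rint_cst]. Qed.

Lemma L2_addZ (x v : Gstar -> H) (t : R) : L2 mu H x -> L2 mu H v ->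
  L2 mu H (fun g => x g + t *: v g).
Proof.
move=> /L2P[mx ix] /L2P[mv iv]; apply/L2P.
have m : measurable_fun setT ((fun g => x g + t *: v g) : BGstar R -> Borel H).
  exact: measurable_addZH.
split=> //; apply: (le_integrable _ _ _ (rintD (rintZ 2 ix) (rintZ (2 * t ^+ 2) iv))) => //.
  by apply/measurable_EFinP; apply: measurable_funX; exact: measurable_normH.
move=> g _ /=; rewrite lee_fin ger0_norm ?exprn_ge0//.
apply: le_trans (ler_norm _); apply: (le_trans (ler_normD_sqr _ _)).
by rewrite lerD2l normrZ exprMn real_normK ?num_real// mulrA.
Qed.

End L2_space.

Section potential.
Context (R : realType) (H : hilbertType R) (sepH : separable_space H).
Context (mu : probability (BGstar R) R) (unimu : unimodular mu).
Context (f : Gstar -> H -> R) (h psi : Gstar2 -> H -> H -> R).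
Context (adm : admissible mu f h psi).
Context (Lf Lh : R) (D : nat) (N0 N : set (BGstar R)).
Context (Lf0 : 0 <= Lf) (Lh0 : 0 <= Lh).
Context (mN0 : measurable N0) (muN0 : mu N0 = 0%E).
Context (mN : measurable N) (muN : mu N = 0%E) (N0N : N0 `<=` N).
Context (goodr : forall g, ~ N0 g -> good_root f Lf D g).
Context (goode : forall z, adj z -> ~ N0 (pi1 z) -> good_edge h psi Lh z).
Context (nbrN : forall g, ~ N g -> forall v, rnbrs g v -> ~ N0 (cls1 v)).

Notation G1 := (BGstar R).
Notation G2 := (BGstar2 R).
Notation rint F := (mu.-integrable setT (EFin \o (F : G1 -> R))).

(** * Gradients set to zero off the good set, and their measurability *)

Definition in_good (g : Gstar) : bool := g \notin N0.

Definition root_grad (x : Gstar -> H) (g : Gstar) : H :=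
  if in_good g then grad (f g) (x g) else 0.

(** The test on [adj] is there because differentiability of h is assumed only at edges, while
    measurability is needed on all of [Gstar2]. *)
Definition edge_grad (x : Gstar -> H) (z : Gstar2) : H :=
  if adj z && in_good (pi1 z) then grad1 (h z) (x (pi1 z)) (x (pi2 z)) else 0.

Lemma in_goodP g : in_good g <-> ~ N0 g.
Proof. by rewrite /in_good notin_setE. Qed.

Lemma good_rnbrs g v : ~ N g -> rnbrs g v ->
  let z := cls2 (groot g) v in
  [/\ adj z, in_good (pi1 z), adj (swap z) & in_good (pi1 (swap z))].
Proof.
move=> Ng gv /=; rewrite adj_swap pi1_swap adj_cls2 pi1_cls2 pi2_cls2 cls1_groot.
by split=> //; apply/in_goodP; [move/N0N|exact: nbrN gv].
Qed.

Lemma measurable_in_good : measurable_fun setT ((fun g => (in_good g)%:R) : G1 -> R).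
Proof.
rewrite (_ : (fun g => _) = \1_(~` N0)).
  by apply: measurable_indic; exact: measurableC.
by apply/funext => g; rewrite indicE in_setC.
Qed.

Lemma measurable_f (y : Gstar -> H) : measurable_fun setT (y : G1 -> Borel H) ->
  measurable_fun setT ((fun g => f g (y g)) : G1 -> R).
Proof.
move=> my; apply: (measurableT_comp (g := (fun g => (g, y g)) : G1 -> G1 * Borel H)
  (adm_meas_f adm)).
by apply: measurable_fun_pair => //; exact: measurable_id.
Qed.

Lemma measurable_root_grad x : measurable_fun setT (x : G1 -> Borel H) ->
  measurable_fun setT (root_grad x : G1 -> Borel H).
Proof.
move=> mx; apply: (measurable_weak sepH) => u.
apply: (@measurable_fun_cvg _ G1 R _ (fun n g => (in_good g)%:R *
    (n.+1%:R * (f g (x g + n.+1%:R^-1 *: u) - f g (x g))))).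
  move=> n; apply: measurable_funM; first exact: measurable_in_good.
  apply: measurable_funM => //; apply: measurable_funB; last exact: measurable_f.
  by apply: measurable_f; apply: measurable_addZH => //; exact: measurable_cst.
move=> g _; rewrite /root_grad; case: ifPn => [/in_goodP/goodr[dfg _ _]|_]; last first.
  by under eq_fun do rewrite mul0r; rewrite inner0l; exact: cvg_cst.
under eq_fun do rewrite mul1r.
exact: gradient_cvg_seq (gradP (dfg _)) I.
Qed.

Lemma measurable_on_edges (k : Gstar2 -> H -> H -> R) (a b : Gstar2 -> H) :
  measurable_fun setT
    (fun p : G2 * Borel H * Borel H => k p.1.1 p.1.2 p.2) ->
  measurable_fun setT (a : G2 -> Borel H) -> measurable_fun setT (b : G2 -> Borel H) ->
  measurable_fun setT ((fun z => k z (a z) (b z)) : G2 -> R).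
Proof.
move=> mk ma mb.
apply: (measurableT_comp (g := (fun z => (z, a z, b z)) : G2 -> G2 * Borel H * Borel H) mk).
by apply: measurable_fun_pair => //; apply: measurable_fun_pair.
Qed.

Lemma measurable_comp_pi1 (x : Gstar -> H) : measurable_fun setT (x : G1 -> Borel H) ->
  measurable_fun setT ((fun z => x (pi1 z)) : G2 -> Borel H).
Proof. by move=> mx; exact: (measurableT_comp mx (@measurable_pi1 R)). Qed.

Lemma measurable_comp_pi2 (x : Gstar -> H) : measurable_fun setT (x : G1 -> Borel H) ->
  measurable_fun setT ((fun z => x (pi2 z)) : G2 -> Borel H).
Proof. by move=> mx; exact: (measurableT_comp mx (@measurable_pi2 R)). Qed.

Lemma measurable_edge_grad x : measurable_fun setT (x : G1 -> Borel H) ->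
  measurable_fun setT (edge_grad x : G2 -> Borel H).
Proof.
move=> mx; apply: (measurable_weak sepH) => u.
have [mx1 mx2] := (measurable_comp_pi1 mx, measurable_comp_pi2 mx).
apply: (@measurable_fun_cvg _ G2 R _ (fun n z => (adj z)%:R * (in_good (pi1 z))%:R *
    (n.+1%:R * (h z (x (pi1 z) + n.+1%:R^-1 *: u) (x (pi2 z)) -
                h z (x (pi1 z)) (x (pi2 z)))))).
  move=> n; apply: measurable_funM; first apply: measurable_funM.
  - exact: measurable_adj.
  - exact: (measurableT_comp measurable_in_good (@measurable_pi1 R)).
  apply: measurable_funM => //; apply: measurable_funB.
  - apply: (measurable_on_edges (adm_meas_h adm)) => //.
    by apply: measurable_addZH => //; exact: measurable_cst.
  - exact: (measurable_on_edges (adm_meas_h adm)).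
move=> z _; rewrite /edge_grad; case: ifPn => [/andP[az gz]|zF]; last first.
  under eq_fun do rewrite -natrM mulnb (negbTE zF) mul0r.
  by rewrite inner0l; exact: cvg_cst.
rewrite az gz; under eq_fun do rewrite !mul1r.
have [dh _ _ _] := goode az (iffLR (in_goodP _) gz).
exact: gradient_cvg_seq (gradP (dh _ _)) I.
Qed.

(** Converts the integrability hypotheses, whose integrand [K] may contain uncontrolled gradients on
    [N0], into integrability of a measurable [F]. *)
Lemma rint_of_lty (F K : Gstar -> R) : measurable_fun setT (F : G1 -> R) ->
  (forall g, ~ N0 g -> K g = `|F g|) -> (\int[mu]_g (K g)%:E < +oo)%E -> rint F.
Proof.
move=> mF KF iK; apply/integrableP; split; first exact/measurable_EFinP.
rewrite (eq_integral_off_null mN0 muN0 (g := fun g => (K g)%:E))// => g Ng.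
by rewrite /= KF.
Qed.

(** * Integrability of the gradients, starting from a constant function *)

Lemma root_grad_good x g : ~ N0 g -> root_grad x g = grad (f g) (x g).
Proof. by move=> /in_goodP Ng; rewrite /root_grad Ng. Qed.

Lemma edge_grad_good x z : adj z -> in_good (pi1 z) ->
  edge_grad x z = grad1 (h z) (x (pi1 z)) (x (pi2 z)).
Proof. by move=> az gz; rewrite /edge_grad az gz. Qed.

Lemma measurable_sqr_root_grad x : measurable_fun setT (x : G1 -> Borel H) ->
  measurable_fun setT ((fun g => `|root_grad x g| ^+ 2) : G1 -> R).
Proof.
move=> mx; apply: measurable_funX; apply: measurable_normH => //.
exact: measurable_root_grad.
Qed.

Lemma measurable_sqr_edge_grad x : measurable_fun setT (x : G1 -> Borel H) ->
  measurable_fun setT ((fun z => `|edge_grad x z| ^+ 2) : G2 -> R).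
Proof.
move=> mx; apply: measurable_funX; apply: measurable_normH => //.
exact: measurable_edge_grad.
Qed.

Lemma density_nsum x g : potential_density f psi x g =
  f g (x g) + 2^-1 * nsum (fun z => psi z (x (pi1 z)) (x (pi2 z))) g.
Proof.
congr (_ + _ * _); apply: eq_fsbigr => v _.
by rewrite pi1_cls2 pi2_cls2 cls1_groot.
Qed.

Lemma measurable_psi (x : Gstar -> H) : measurable_fun setT (x : G1 -> Borel H) ->
  measurable_fun setT ((fun z => psi z (x (pi1 z)) (x (pi2 z))) : G2 -> R).
Proof.
move=> mx; apply: (measurable_on_edges (adm_meas_psi adm)).
- exact: measurable_comp_pi1.
- exact: measurable_comp_pi2.
Qed.

Lemma measurable_density x : measurable_fun setT (x : G1 -> Borel H) ->
  measurable_fun setT (potential_density f psi x : G1 -> R).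
Proof.
move=> mx; rewrite (_ : potential_density f psi x = fun g => f g (x g) +
    2^-1 * nsum (fun z => psi z (x (pi1 z)) (x (pi2 z))) g).
  apply: measurable_funD; first exact: measurable_f.
  by apply: measurable_funM => //; apply: measurable_nsum; exact: measurable_psi.
by apply/funext => g; rewrite density_nsum.
Qed.

Lemma base_point : exists c : H, let x := fun _ : Gstar => c in
  [/\ rint (potential_density f psi x),
      rint (fun g => `|root_grad x g| ^+ 2) &
      rint (nsum (fun z => `|edge_grad x z| ^+ 2))].
Proof.
have [c [fc gfc psic ghc]] := adm_integrable adm; exists c => x.
have mx : measurable_fun setT (x : G1 -> Borel H) by exact: measurable_cst.
split.
- rewrite (_ : potential_density f psi x = fun g => f g (x g) +
    2^-1 * nsum (fun z => psi z (x (pi1 z)) (x (pi2 z))) g); last first.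
    by apply/funext => g; rewrite density_nsum.
  apply: rintD; first by apply: rint_of_lty fc => //; exact: measurable_f.
  apply: rintZ.
  have mpsi := measurable_psi mx.
  suff ipsi : rint (nsum (fun z => `|psi z (x (pi1 z)) (x (pi2 z))|)).
    apply: (le_integrable _ _ _ ipsi) => //.
      by apply/measurable_EFinP; exact: measurable_nsum.
    move=> g _; rewrite /= lee_fin (le_trans (ler_norm_nsum _ _))//.
    exact: ler_norm.
  apply: rint_of_lty psic.
    apply: measurable_nsum; exact: measurableT_comp mpsi.
  by move=> g _; rewrite ger0_norm//; exact: nsum_ge0.
- apply: rint_of_lty gfc; first exact: measurable_sqr_root_grad.
  by move=> g Ng; rewrite root_grad_good// ger0_norm// exprn_ge0.
- apply: rint_of_lty ghc.
    by apply: measurable_nsum; exact: measurable_sqr_edge_grad.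
  move=> g Ng; rewrite ger0_norm; last by apply: nsum_ge0 => v _; exact: exprn_ge0.
  apply: eq_fsbigr => v /set_mem gv; rewrite edge_grad_good ?adj_cls2//.
  by rewrite pi1_cls2 cls1_groot; exact/in_goodP.
Qed.

Lemma nsum_le_deg (a : R) g : 0 <= a -> ~ N0 g -> nsum (fun=> a) g <= D%:R * a.
Proof.
move=> a0 /goodr[_ _ /(_ (groot g)) degD].
rewrite nsumE big_const_seq count_predT iter_addr addr0 -[leLHS]mulr_natl.
by rewrite ler_wpM2r// ler_nat.
Qed.

Lemma rint_sqr_pi1 x : L2 mu H x -> rint (nsum (fun z => `|x (pi1 z)| ^+ 2)).
Proof.
move=> /(L2P sepH)[mx ix].
apply: (le_integrable_off_null mN0 muN0 _ (rintZ D%:R ix)).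
  apply: measurable_nsum; apply: measurable_funX; apply: measurable_normH => //.
  exact: measurable_comp_pi1.
move=> g Ng; rewrite ger0_norm; last by apply: nsum_ge0 => v _; exact: exprn_ge0.
apply: le_trans (nsum_le_deg _ Ng); last exact: exprn_ge0.
by apply: le_nsum => v _; rewrite pi1_cls2 cls1_groot.
Qed.

(** The transported form of [rint_sqr_pi1], where at most D equal terms were summed. *)
Lemma rint_sqr_pi2 x : L2 mu H x -> rint (nsum (fun z => `|x (pi2 z)| ^+ 2)).
Proof.
move=> L2x; have /(L2P sepH)[mx ix] := L2x.
have m1 : measurable_fun setT ((fun z => `|x (pi1 z)| ^+ 2) : G2 -> R).
  by apply: measurable_funX; apply: measurable_normH => //; exact: measurable_comp_pi1.
have [|_ + _ _] := rint_swap unimu m1.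
  rewrite (_ : (fun z => `|_|) = (fun z => `|x (pi1 z)| ^+ 2)); first exact: rint_sqr_pi1.
  by apply/funext => z; rewrite ger0_norm// exprn_ge0.
rewrite (_ : _ \o swap = fun z => `|x (pi2 z)| ^+ 2)//.
by apply/funext => z; rewrite /= pi1_swap.
Qed.

(** Comparison with the base point [c]: the Lipschitz bound controls the difference of the gradients
    by Lf |x - c|, and x - c is in L^2 because mu is finite. *)
Lemma rint_sqr_root_grad x : L2 mu H x -> rint (fun g => `|root_grad x g| ^+ 2).
Proof.
move=> L2x; have [c [_ ic _]] := base_point; have /(L2P sepH)[mx _] := L2x.
have /(L2P sepH)[_ id] := L2_addZ sepH (-1) L2x (L2_cst sepH mu c).
apply: (le_integrable_off_null mN0 muN0 (measurable_sqr_root_grad mx)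
  (rintD (rintZ 2 ic) (rintZ (2 * Lf ^+ 2) id))) => g Ng.
have [_ lip _] := goodr Ng.
rewrite ger0_norm ?exprn_ge0// !root_grad_good//.
set u := grad _ (x g); set w := grad _ c.
rewrite -(subrKC w u) (le_trans (ler_normD_sqr _ _))// lerD2l -mulrA ler_wpM2l//.
by rewrite -exprMn ler_sqr ?nnegrE ?mulr_ge0// scaleN1r; exact: lip.
Qed.

Lemma rint_sqr_edge_grad x : L2 mu H x -> rint (nsum (fun z => `|edge_grad x z| ^+ 2)).
Proof.
move=> L2x; have [c [_ _ ic]] := base_point; have /(L2P sepH)[mx _] := L2x.
have L2d := L2_addZ sepH (-1) L2x (L2_cst sepH mu c).
(* The 4 combines the 2 of |u + v|^2 <= 2|u|^2 + 2|v|^2 with that of (a + b)^2 <= 2a^2 + 2b^2. *)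
have iK := rintD (rintZ 2 ic) (rintZ (4 * Lh ^+ 2)
  (rintD (rint_sqr_pi1 L2d) (rint_sqr_pi2 L2d))).
apply: (le_integrable_off_null mN muN _ iK).
  by apply: measurable_nsum; exact: measurable_sqr_edge_grad.
move=> g Ng; rewrite ger0_norm; last by apply: nsum_ge0 => v _; exact: exprn_ge0.
rewrite -nsumZ -nsumD -nsumZ -nsumD; apply: le_nsum => v gv.
have [az gz _ _] := good_rnbrs Ng gv; move: az gz; set z := cls2 _ v => az gz.
have [_ _ _ lip] := goode az (iffLR (in_goodP _) gz).
rewrite !edge_grad_good// !scaleN1r.
set u := grad1 _ (x _) _; set w := grad1 _ c c.
rewrite -(subrKC w u) (le_trans (ler_normD_sqr _ _))// lerD2l.
have := lip (x (pi1 z)) c (x (pi2 z)) c; rewrite -/u -/w.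
move: `|u - w| (normr_ge0 (u - w)) `|x (pi1 z) - c| `|x (pi2 z) - c| => p p0 a b pab.
have : p ^+ 2 <= (Lh * (a + b)) ^+ 2.
  by rewrite ler_sqr// nnegrE (le_trans p0).
have : 0 <= Lh ^+ 2 * (a - b) ^+ 2 by rewrite mulr_ge0// sqr_ge0.
lra.
Qed.

(** * Taylor estimates for the density *)

Lemma root_taylor g (a u : H) : ~ N0 g ->
  `|f g (a + u) - f g a - inner (grad (f g) a) u| <= Lf * `|u| ^+ 2.
Proof.
move=> /goodr[dfg lip _]; have [s /andP[s0 s1] ->] := grad_mvt a u dfg.
rewrite -innerBl (le_trans (ler_norm_inner _ _))// expr2 mulrA ler_wpM2r//.
rewrite (le_trans (lip _ _))// ler_wpM2l// (addrC a) addrK normrZ ger0_norm//.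
by rewrite ler_piMl.
Qed.

(** The two partial gradients of psi are those of h at the edge and at its reverse. Each varies by
    at most Lh (|u| + |w|), giving Lh (|u| + |w|)^2 in total, which is at most the stated bound. *)
Lemma edge_taylor z (a b u w : H) :
  good_edge h psi Lh z -> good_edge h psi Lh (swap z) ->
  `|psi z (a + u) (b + w) - psi z a b -
    (inner (grad1 (h z) a b) u + inner (grad1 (h (swap z)) b a) w)|
  <= 2 * Lh * (`|u| ^+ 2 + `|w| ^+ 2).
Proof.
move=> [_ dpsi gpsi lip] [_ _ _ lips].
have [s /andP[s0 s1] ->] := grad2_mvt a b u w dpsi.
have [-> ->] := gpsi (a + s *: u) (b + s *: w).
rewrite opprD addrACA -!innerBl (le_trans (ler_normD _ _))//.
have lsu (e : H) : `|s *: e| <= `|e| by rewrite normrZ ger0_norm// ler_piMl.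
have l1 : `|grad1 (h z) (a + s *: u) (b + s *: w) - grad1 (h z) a b| <=
    Lh * (`|u| + `|w|).
  by rewrite (le_trans (lip _ _ _ _))// ler_wpM2l// lerD// ?(addrC a) ?(addrC b) addrK.
have l2 : `|grad1 (h (swap z)) (b + s *: w) (a + s *: u) -
    grad1 (h (swap z)) b a| <= Lh * (`|u| + `|w|).
  rewrite (le_trans (lips _ _ _ _))// ler_wpM2l// [leRHS]addrC.
  by rewrite lerD// ?(addrC a) ?(addrC b) addrK.
have := le_trans (ler_norm_inner _ u) (ler_wpM2r (normr_ge0 u) l1).
have := le_trans (ler_norm_inner _ w) (ler_wpM2r (normr_ge0 w) l2).
have : 0 <= Lh * (`|u| - `|w|) ^+ 2 by rewrite mulr_ge0// sqr_ge0.
lra.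
Qed.

Definition edge_pairing (x v : Gstar -> H) (z : Gstar2) : R :=
  inner (edge_grad x z) (v (pi1 z)).

Definition density_deriv (x v : Gstar -> H) (g : Gstar) : R :=
  inner (root_grad x g) (v g) +
  2^-1 * (nsum (edge_pairing x v) g + nsum (edge_pairing x v \o swap) g).

(** The constant is [Lh], not the [2 * Lh] of [edge_taylor], thanks to the factor 1/2 in the
    density. *)
Definition taylor_bound (v : Gstar -> H) (g : Gstar) : R :=
  Lf * `|v g| ^+ 2 +
  Lh * (nsum (fun z => `|v (pi1 z)| ^+ 2) g + nsum (fun z => `|v (pi2 z)| ^+ 2) g).

Lemma density_taylor x v t g : ~ N g ->
  `|potential_density f psi (fun g => x g + t *: v g) g -
    potential_density f psi x g - t * density_deriv x v g|
  <= t ^+ 2 * taylor_bound v g.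
Proof.
move=> Ng; rewrite !density_nsum /density_deriv /taylor_bound.
have N0g : ~ N0 g by move/N0N.
have sqrZ (e : H) : `|t *: e| ^+ 2 = t ^+ 2 * `|e| ^+ 2.
  by rewrite normrZ exprMn real_normK ?num_real.
have r := root_taylor (x g) (t *: v g) N0g.
rewrite innerZr sqrZ -root_grad_good// in r.
rewrite -!nsumD; set K := nsum (fun z => _ ^+ 2 + _) g.
set P := nsum (fun z => edge_pairing x v z + _) g.
set S1 := nsum _ g; set S0 := nsum (fun z => psi z (x _) _) g.
have e : `|S1 - S0 - t * P| <= t ^+ 2 * (2 * Lh * K).
  (* Everything is gathered into one neighbour sum, so that the estimate can be made edge by
     edge. *)
  rewrite mulrA -!nsumZ -!nsumB (le_trans (ler_norm_nsum _ _))//.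
  apply: le_nsum => w gw; have [] := good_rnbrs Ng gw.
  set z := cls2 _ w => az gz asz gsz.
  have := edge_taylor (x (pi1 z)) (x (pi2 z)) (t *: v (pi1 z)) (t *: v (pi2 z))
    (goode az (iffLR (in_goodP _) gz)) (goode asz (iffLR (in_goodP _) gsz)).
  rewrite !innerZr !sqrZ /edge_pairing /= !edge_grad_good// pi1_swap pi2_swap.
  by rewrite -!mulrDr [X in _ <= X -> _]mulrCA mulrA.
move: r e.
move: (f g _) (f g _) (inner _ _) (`|v g| ^+ 2) => a a' b q.
rewrite !ler_norml => /andP[r1 r2] /andP[e1 e2].
apply/andP; split; lra.
Qed.

(** The bound |<u, v>| <= |u|^2 + |v|^2 gives integrability, and mass transport gives the rest. *)
Lemma rint_edge_pairing x v : L2 mu H x -> L2 mu H v ->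
  [/\ rint (nsum (edge_pairing x v)), rint (nsum (edge_pairing x v \o swap)) &
    \int[mu]_g nsum (edge_pairing x v) g =
    \int[mu]_g nsum (edge_pairing x v \o swap) g].
Proof.
move=> L2x L2v; have [/(L2P sepH)[mx _] /(L2P sepH)[mv _]] := (L2x, L2v).
have mB : measurable_fun setT (edge_pairing x v : G2 -> R).
  by apply: measurable_innerH => //; [exact: measurable_edge_grad|exact: measurable_comp_pi1].
have [|] := rint_swap unimu mB; last by [].
have iK := rintD (rint_sqr_edge_grad L2x) (rint_sqr_pi1 L2v).
apply: (le_integrable_off_null mN0 muN0 _ iK).
  by apply: measurable_nsum; exact: measurableT_comp mB.
move=> g _; rewrite ger0_norm; last by apply: nsum_ge0.
by rewrite -nsumD; apply: le_nsum => w _; exact: ler_norm_inner_sqr.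
Qed.

Lemma rint_root_pairing x v : L2 mu H x -> L2 mu H v ->
  rint (fun g => inner (root_grad x g) (v g)).
Proof.
move=> L2x L2v; have [/(L2P sepH)[mx _] /(L2P sepH)[mv iv]] := (L2x, L2v).
apply: (le_integrable_off_null mN0 muN0 _ (rintD (rint_sqr_root_grad L2x) iv)).
  by apply: measurable_innerH => //; exact: measurable_root_grad.
by move=> g _; exact: ler_norm_inner_sqr.
Qed.

Lemma rint_taylor_bound v : L2 mu H v -> rint (taylor_bound v).
Proof.
move=> L2v; have /(L2P sepH)[_ iv] := L2v.
exact: rintD (rintZ Lf iv) (rintZ Lh (rintD (rint_sqr_pi1 L2v) (rint_sqr_pi2 L2v))).
Qed.

Lemma rint_density_deriv x v : L2 mu H x -> L2 mu H v -> rint (density_deriv x v).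
Proof.
move=> L2x L2v; have [i1 i2 _] := rint_edge_pairing L2x L2v.
exact: rintD (rint_root_pairing L2x L2v) (rintZ _ (rintD i1 i2)).
Qed.

Lemma rint_norm (F : Gstar -> R) : rint F -> rint (fun g => `|F g|).
Proof.
move=> iF; apply: (le_integrable _ _ _ iF) => //.
  by apply/measurable_EFinP; exact: measurableT_comp (rint_measurable iF).
by move=> g _; rewrite /= normr_id.
Qed.

Lemma rint_density x : L2 mu H x -> rint (potential_density f psi x).
Proof.
move=> L2x; have [c [ic _ _]] := base_point.
have L2c := L2_cst sepH mu c; have L2d := L2_addZ sepH (-1) L2x L2c.
have /(L2P sepH)[mx _] := L2x.
have iK := rintD (rintD (rint_norm ic) (rint_norm (rint_density_deriv L2c L2d)))
  (rint_taylor_bound L2d).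
apply: (le_integrable_off_null mN muN (measurable_density mx) iK) => g Ng.
(* Expansion from [c] in the direction x - c with t = 1 reaches x; the density at x is then
   dominated by its value at [c], the derivative and the remainder. *)
have := density_taylor (fun=> c) (fun g => x g + -1 *: c) 1 Ng.
rewrite (_ : (fun g => c + 1 *: (x g + -1 *: c)) = x); last first.
  by apply/funext => k; rewrite scale1r scaleN1r addrC subrK.
rewrite expr1n !mul1r => dT.
rewrite -[X in `|X| <= _](subrK (potential_density f psi (fun=> c) g +
  density_deriv (fun=> c) (fun g => x g + -1 *: c) g)).
rewrite (le_trans (ler_normD _ _))// addrC lerD ?ler_normD//.
by rewrite opprD addrA.
Qed.

(** * The gradient of the potential *)

Definition total_grad (x : Gstar -> H) (g : Gstar) : H :=
  root_grad x g + \sum_(v \in rnbrs g) edge_grad x (cls2 (groot g) v).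

Lemma inner_total_grad x u g : inner (total_grad x g) u =
  inner (root_grad x g) u + nsum (fun z => inner (edge_grad x z) u) g.
Proof.
rewrite innerDl nsumE fsbig_finite; last exact: finite_nbrs.
congr (_ + _); elim: (enum_fset _) => [|v s IH]; first by rewrite !big_nil inner0l.
by rewrite !big_cons innerDl IH.
Qed.

Lemma inner_total_grad_pairing x y g : inner (total_grad x g) (y g) =
  inner (root_grad x g) (y g) + nsum (edge_pairing x y) g.
Proof.
rewrite inner_total_grad; congr (_ + _); apply: eq_nsum => v _.
by rewrite /edge_pairing pi1_cls2 cls1_groot.
Qed.

Lemma L2_total_grad x : L2 mu H x -> L2 mu H (total_grad x).
Proof.
move=> L2x; have /(L2P sepH)[mx _] := L2x; apply/(L2P sepH).
have mT : measurable_fun setT (total_grad x : G1 -> Borel H).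
  apply: (measurable_weak sepH) => u.
  rewrite (_ : (fun g => _) = fun g => inner (root_grad x g) u +
      nsum (fun z => inner (edge_grad x z) u) g); last first.
    by apply/funext => g; exact: inner_total_grad.
  apply: measurable_funD; last apply: measurable_nsum.
  - by apply: measurable_innerH => //; exact: measurable_root_grad.
  - by apply: measurable_innerH => //; exact: measurable_edge_grad.
split=> //.
have iK := rintD (rintZ 2 (rint_sqr_root_grad L2x))
  (rintZ 2 (rintZ D.+1%:R (rint_sqr_edge_grad L2x))).
apply: (le_integrable_off_null mN0 muN0 _ iK).
  by apply: measurable_funX; exact: measurable_normH.
move=> g Ng; rewrite ger0_norm ?exprn_ge0// (le_trans (ler_normD_sqr _ _))// lerD2l.
rewrite ler_wpM2l//; set S := nsum (fun z => `|edge_grad x z|) g.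
have S0 : 0 <= S by apply: nsum_ge0.
apply: (@le_trans _ _ (S ^+ 2)).
  rewrite ler_sqr ?nnegrE// fsbig_finite; last exact: finite_nbrs.
  by rewrite /S nsumE; exact: ler_norm_sum.
set Q := nsum _ g.
(* Cauchy-Schwarz for a sum of at most D terms, from sum (m |W| - S)^2 >= 0 *)
have : 0 <= nsum (fun z => (D.+1%:R * `|edge_grad x z| - S) ^+ 2) g.
  by apply: nsum_ge0 => v _; exact: sqr_ge0.
(* The weight is m = D + 1 rather than D, so that it can be cancelled even when D = 0. *)
have m0 : 0 < D.+1%:R :> R by rewrite ltr0n.
have := nsum_le_deg (sqr_ge0 S) Ng.
have -> : nsum (fun z => (D.+1%:R * `|edge_grad x z| - S) ^+ 2) g =
    D.+1%:R ^+ 2 * Q - 2 * D.+1%:R * S * S + nsum (fun=> S ^+ 2) g.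
  rewrite /Q -nsumZ -[2 * _ * S * S]nsumZ -nsumB -nsumD; apply: eq_nsum => v _.
  lra.
move=> h1 h2; rewrite -(ler_pM2l m0).
have : D%:R * S ^+ 2 <= D.+1%:R * S ^+ 2 by rewrite ler_wpM2r ?sqr_ge0// ler_nat.
lra.
Qed.

Lemma potential_taylor x v t : L2 mu H x -> L2 mu H v ->
  `|potential mu f psi (fun g => x g + t *: v g) - potential mu f psi x -
    t * innerL2 mu (total_grad x) v|
  <= t ^+ 2 * \int[mu]_g taylor_bound v g.
Proof.
move=> L2x L2v; have [i1 i2 i12] := rint_edge_pairing L2x L2v.
have ir := rint_root_pairing L2x L2v.
have -> : innerL2 mu (total_grad x) v = \int[mu]_g density_deriv x v g.
  rewrite /density_deriv RintegralD//; last exact: rintZ _ (rintD i1 i2).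
  rewrite RintegralZl//; last exact: rintD i1 i2.
  (* Mass transport identifies the two edge integrals, and their sum absorbs the factor 1/2. *)
  rewrite RintegralD// -i12 -mulr2n -[X in _ * X]mulr_natl mulKf ?pnatr_eq0//.
  rewrite -RintegralD//; apply: eq_Rintegral => g _.
  exact: inner_total_grad_pairing.
have id := rint_density_deriv L2x L2v.
have [ix ixv] := (rint_density L2x, rint_density (L2_addZ sepH t L2x L2v)).
have iK := rint_taylor_bound L2v.
rewrite /potential -!RintegralZl// -!RintegralB//; [|exact: rintB|exact: rintZ].
apply: (le_Rintegral_off_null mN muN).
- by apply: rintB (rintZ t id); exact: rintB.
- exact: rintZ.
- by move=> g Ng; exact: density_taylor.
Qed.

(** Dividing the Taylor estimate by t leaves an error of at most |t| C, with C depending only on the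
    direction. *)
Lemma is_gradient_potential x : L2 mu H x ->
  is_gradient (L2 mu H) (innerL2 mu) (potential mu f psi) x (total_grad x).
Proof.
move=> L2x; split; first exact: L2_total_grad.
move=> v L2v; set L := innerL2 _ _ _; set C := \int[mu]_g taylor_bound v g.
have C0 : 0 <= C.
  have := potential_taylor 1 L2x L2v; rewrite expr1n !mul1r.
  exact: (le_trans (normr_ge0 _)).
apply/cvgrPdist_lt => e e0.
(* C + 1 avoids a division by zero when C = 0. *)
have eC : 0 < e / (C + 1) by rewrite divr_gt0// ltr_wpDl.
exists (e / (C + 1)) => //= t; rewrite /ball_ /= sub0r normrN => te t0.
have t_gt0 : 0 < `|t| by rewrite normr_gt0.
rewrite distrC -(ltr_pM2l t_gt0) -normrM mulrBr mulrA mulfV// mul1r.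
have := potential_taylor t L2x L2v; rewrite -/L -/C => /le_lt_trans; apply.
rewrite -real_normK ?num_real// expr2 -mulrA ltr_pM2l//.
have : `|t| * (C + 1) < e by rewrite -ltr_pdivlMr// ltr_wpDl.
by have := normr_ge0 t; nra.
Qed.

Lemma gradient_potential x y : L2 mu H x -> L2 mu H y ->
  (innerL2 mu (gradient (L2 mu H) (innerL2 mu) (potential mu f psi) x) y)%:E
  = (\int[mu]_g (inner (grad (f g) (x g)
        + \sum_(v \in rnbrs g)
            grad1 (h (cls2 (groot g) v)) (x g) (x (cls1 v))) (y g))%:E)%E.
Proof.
move=> L2x L2y; have Gx := is_gradient_potential L2x.
have -> : innerL2 mu (gradient (L2 mu H) (innerL2 mu) (potential mu f psi) x) y =
    innerL2 mu (total_grad x) y.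
  (* The chosen gradient need not be [total_grad] pointwise, but both pair with [y] to the same
     limit of difference quotients. *)
  rewrite /gradient; case: xgetP => [k _ kx|/(_ (total_grad x))//].
  exact: cvg_unique (kx.2 y L2y) (Gx.2 y L2y).
(* Once the integral is known to be finite, the zeroed gradients are replaced by the true ones,
   which differ from them only on a null set. *)
rewrite /innerL2 /Rintegral fineK.
  apply: (eq_integral_off_null mN0 muN0) => g Ng; congr (inner (_ + _) _)%:E.
    exact: root_grad_good.
  apply: eq_fsbigr => v /set_mem gv; rewrite edge_grad_good ?adj_cls2//.
    by rewrite pi1_cls2 pi2_cls2 cls1_groot.
  by rewrite pi1_cls2 cls1_groot; exact/in_goodP.
apply: integrable_fin_num => //; have [i1 _ _] := rint_edge_pairing L2x L2y.
rewrite (_ : (fun g => _) = EFin \o (fun g => inner (root_grad x g) (y g) +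
  nsum (edge_pairing x y) g)); first exact: rintD (rint_root_pairing L2x L2y) i1.
by apply/funext => g; rewrite /= inner_total_grad_pairing.
Qed.

End potential.

(** A real-valued integral takes the default value 0 when the extended one is infinite. The first
    clause excludes this for the potential, and the equality in [\bar R] does so for the gradient
    formula. *)
Theorem proposition3p2 (R : realType) (H : hilbertType R) (sepH : separable_space H)
    (mu : probability (BGstar R) R)
    (mu_unimodular : unimodular mu) (mu_bounded_degree : bounded_degree mu)
    (f : Gstar -> H -> R) (h psi : Gstar2 -> H -> H -> R)
    (f_h_psi_admissible : admissible mu f h psi)
    (x y : Gstar -> H) (x_L2 : L2 mu H x) (y_L2 : L2 mu H y) :
  [/\ forall z, L2 mu H z ->
        (\int[mu]_g (potential_density f psi z g)%:E)%E \is a fin_num,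
      gateaux_differentiable (L2 mu H) (innerL2 mu) (potential mu f psi) x &
      (innerL2 mu (gradient (L2 mu H) (innerL2 mu) (potential mu f psi) x) y)%:E
      = (\int[mu]_g (inner (grad (f g) (x g)
            + \sum_(v \in rnbrs g)
                grad1 (h (cls2 (groot g) v)) (x g) (x (cls1 v))) (y g))%:E)%E].
Proof.
have [Lf [Lh [D [N0 [N [Lf0 Lh0 [mN0 muN0 mN muN N0N] gr [ge nb]]]]]]] :=
  admissible_good mu_unimodular mu_bounded_degree f_h_psi_admissible.
split.
- move=> z L2z; apply: integrable_fin_num => //.
  exact: (rint_density sepH mu_unimodular f_h_psi_admissible Lf0 Lh0
    mN0 muN0 mN muN N0N gr ge nb L2z).
- exists (total_grad f h N0 x).
  exact: (is_gradient_potential sepH mu_unimodular f_h_psi_admissible Lf0 Lh0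
    mN0 muN0 mN muN N0N gr ge nb x_L2).
- exact: (gradient_potential sepH mu_unimodular f_h_psi_admissible Lf0 Lh0
    mN0 muN0 mN muN N0N gr ge nb x_L2 y_L2).
Qed.
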